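(* Let $m\ge 1$ and let $a$, $b=(b_1,\dots,b_m)$, $c=(c_1,\dots,c_m)$ be complex parameters with $c_1,\dots,c_m\notin\{0,-1,-2,\dots\}$ such that $\beta_{0,i},\ \beta_{1,i},\ \gamma_v\notin\mathbb{Z}$ for all $i\in\{1,\dots,m\}$ and all $v\in\mathbb{Z}_2^m$. Define the vector valued function $F(x)={}^t(\dots,F_v(x),\dots)_{v\in\mathbb{Z}_2^m}$ on $\mathbb{D}=\{x\in\mathbb{C}^m\mid \sum_{i=1}^m|x_i|<1\}$ by $$F_{(0,\dots,0)}(x)=\Big(\prod_{i=1}^m\frac{\Gamma(b_i)\Gamma(c_i-b_i)}{\Gamma(c_i)}\Big)F_A(a,b,c;x),\qquad F_v(x)=\Big(\prod_{1\le i\le m,\ v_i=1}x_i\frac{\partial}{\partial x_i}\Big)F_{(0,\dots,0)}(x),$$ where the entries are arrayed by the total order on $\mathbb{Z}_2^m$. Then $F(x)$ satisfies the Pfaffian system $$d_XF(x)=(P\,\Xi_\varPhi\,P^{-1})F(x)$$ (at the points of $\mathbb{D}$ with $x_1\cdots x_m\neq0$, where $\Xi_\varPhi$ is defined), where $d_X$ is the exterior derivative in $x$, $P=(p_{vw})_{v,w\in\mathbb{Z}_2^m}$ is the (invertible) matrix $$p_{vw}=\begin{cases}\prod_{1\le i\le m,\ v_i=1}(-\beta_{w_i,i}) & \text{if } v\succeq w,\\ 0&\text{otherwise,}\end{cases}$$ and $$\Xi_\varPhi=\sum_{k=1}^m(1-c_k)\,\mathrm{id}_{2^m}\frac{dx_k}{x_k}+\sum_{k=1}^m\sum_{v\in\mathbb{Z}_2^m,\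 v_k=0}(\beta_{1,k}\Pi\beta_v)\,C\;{}^t(f_v-f_{\sigma_k\cdot v})(e_v-e_{\sigma_k\cdot v})\frac{dx_k}{x_k}+\sum_{v\in\mathbb{Z}_2^m}(-a\,\Pi\beta_v)\,C\;{}^tf_v\,f_v\,\frac{d(1-v\,{}^tx)}{1-v\,{}^tx}.$$
   Context: Lauricella's hypergeometric series is $$F_A(a,b,c;x)=\sum_{n\in\mathbb{N}^m}\frac{(a,\sum_{i=1}^mn_i)\prod_{i=1}^m(b_i,n_i)}{\prod_{i=1}^m(c_i,n_i)\prod_{i=1}^m(1,n_i)}\prod_{i=1}^mx_i^{n_i},$$ with $\mathbb{N}=\{0,1,2,\dots\}$ and $(\lambda,n)=\lambda(\lambda+1)\cdots(\lambda+n-1)$; it converges in $\mathbb{D}$. Notation. $\mathbb{Z}_2=\{0,1\}\subset\mathbb{N}$. For $v=(v_1,\dots,v_m)\in\mathbb{Z}_2^m$: $|v|=\sum_iv_i$, $v\,{}^tx=\sum_iv_ix_i$, and $\sigma_j\cdot v\in\mathbb{Z}_2^m$ is $v$ with its $j$-th entry replaced by $1-v_j$. Parameters: $\beta_{0,i}=b_i$, $\beta_{1,i}=c_i-1-b_i$, $\gamma_v=a-\sum_{i}v_ic_i+|v|$; $\Sigma\beta_v=\sum_{i=1}^m\beta_{v_i,i}$, $\Pi\beta_v=\prod_{i=1}^m\beta_{v_i,i}$. Partial order: $v\succeq w$ iff ($w_i=1\Rightarrow v_i=1$). Total order: $v>w$ iff $v\neq w$ and either $|v|>|w|$, or $|v|=|w|$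 and $v_i<w_i$ for the minimum index $i$ with $v_i\ne w_i$. Vectors and matrices of size $2^m$ are indexed by $\mathbb{Z}_2^m$ arrayed increasingly in this total order (starting from $(0,\dots,0)$). $e_v$ is the unit row vector of size $2^m$ with entry $1$ at position $v$, and $$f_v=\frac{a-\Sigma\beta_v}{a}e_v-\sum_{j=1}^m\frac{\beta_{1-v_j,j}}{a}e_{\sigma_j\cdot v}.$$ The matrix $C=(C_{v,v'})_{v,v'\in\mathbb{Z}_2^m}$ is $$C_{v,v'}=\sum_{w\in\mathbb{Z}_2^m}A_w\prod_{1\le i\le m,\ w_i=0}\frac{\delta(v_i,v_i')}{\beta_{v_i,i}},$$ with $\delta$ Kronecker's symbol, empty products equal to $1$, and, for $|w|=r$, $$A_w=\sum\frac{1}{\prod_{j=1}^r\gamma_{w^{(j)}}},$$ the sum being over the $r!$ sequences $w=w^{(r)}\succ w^{(r-1)}\succ\cdots\succ w^{(1)}\succ(0,\dots,0)$ in $\mathbb{Z}_2^m$ with $|w^{(j)}|=j$ (so $A_{(0,\dots,0)}=1$). For $v=(0,\dots,0)$ the form $d(1-v\,{}^tx)$ is $0$. *)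

(* Defs.v *)
From HB Require Import structures.
From mathcomp Require Import all_boot all_order all_algebra.
From mathcomp Require Import finmap complex.
From mathcomp Require Import all_classical all_reals all_analysis.
From mathcomp Require summability.

Set Implicit Arguments.
Unset Strict Implicit.
Unset Printing Implicit Defensive.

Import Order.TTheory GRing.Theory Num.Theory.
Import numFieldNormedType.Exports.

Local Open Scope classical_set_scope.
Local Open Scope ring_scope.

(* R[i] also carries an R-module structure, so the topology and the normed
   structure over itself are not found on the bare type R[i]; they are found
   on CC R, through the generic instances for numClosedFieldType. *)
Definition CC (R : realType) : numClosedFieldType := R[i]%C.
Arguments CC : simpl never.

(** Gamma function *)

Definition cexp (R : realType) (z : CC R) : CC R :=
  Complex (expR (complex.Re z) * cos (complex.Im z))
          (expR (complex.Re z) * sin (complex.Im z)).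

(* Euler-Gauss product formula
   Gamma z = lim_n  n! n^z / (z (z + 1) ... (z + n)),
   valid for every z outside {0, -1, -2, ...}. *)
Definition Gamma (R : realType) (z : CC R) : CC R :=
  lim ((fun n : nat => (n`!)%:R * cexp (z * (real_complex R (ln n%:R) : CC R))
                       / \prod_(k < n.+1) (z + k%:R)) @ \oo).

(** Index set Z_2^m; a boolean entry true stands for 1 *)

Notation Z2 m := {ffun 'I_m -> bool}.

Definition weight m (v : Z2 m) : nat := (\sum_i v i)%N.

Definition zero_vec m : Z2 m := [ffun=> false].

Definition flip m (j : 'I_m) (v : Z2 m) : Z2 m :=
  [ffun i => if i == j then ~~ v i else v i].

Definition succeq m (v w : Z2 m) : bool := [forall i, w i ==> v i].

Definition succ_strict m (v w : Z2 m) : bool := (v != w) && succeq v w.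

Definition gt_vec m (v w : Z2 m) : bool :=
  (v != w) &&
  ((weight w < weight v)%N ||
   (weight v == weight w) &&
   [exists i : 'I_m, (v i < w i)%N &&
      [forall j : 'I_m, (j < i)%N ==> (v j == w j)]]).

(* The k-th vector of Z_2^m, in increasing order. *)
Definition vec_at m (k : 'I_(2 ^ m)) : Z2 m :=
  nth (zero_vec m) (sort (fun v w => (v == w) || gt_vec w v) (enum {: Z2 m})) k.

(* s = (w^(1), ..., w^(r)) with
   w = w^(r) > w^(r-1) > ... > w^(1) > 0 and |w^(j)| = j;
   entry j : 'I_r of s is w^(j+1). *)
Definition chain_to m (w : Z2 m) (s : (weight w).-tuple (Z2 m)) : bool :=
  [&& path (fun u v => succ_strict v u) (zero_vec m) s,
      last (zero_vec m) s == w
    & [forall j, weight (tnth s j) == j.+1]].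

Arguments chain_to {m} w s.

Section Pfaffian.
Context {K : numClosedFieldType} {m : nat}.
Variables (a : K) (b c : 'I_m -> K).

Definition beta (e : bool) (i : 'I_m) : K := if e then c i - 1 - b i else b i.

Definition gamma (v : Z2 m) : K :=
  a - \sum_i (v i)%:R * c i + (weight v)%:R.

Definition sum_beta (v : Z2 m) : K := \sum_i beta (v i) i.

Definition prod_beta (v : Z2 m) : K := \prod_i beta (v i) i.

Definition e_vec (v : Z2 m) : 'rV[K]_(2 ^ m) := \row_k (vec_at k == v)%:R.

Definition f_vec (v : Z2 m) : 'rV[K]_(2 ^ m) :=
  ((a - sum_beta v) / a) *: e_vec v
  - \sum_j (beta (~~ v j) j / a) *: e_vec (flip j v).

Definition A_coef (w : Z2 m) : K :=
  \sum_(s : (weight w).-tuple (Z2 m) | chain_to w s)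
    (\prod_j gamma (tnth s j))^-1.

Definition C_coef (v v' : Z2 m) : K :=
  \sum_(w : Z2 m) A_coef w *
    \prod_(i | ~~ w i) ((v i == v' i)%:R / beta (v i) i).

Definition C_mx : 'M[K]_(2 ^ m) := \matrix_(k, l) C_coef (vec_at k) (vec_at l).

Definition p_coef (v w : Z2 m) : K :=
  if succeq v w then \prod_(i | v i) - beta (w i) i else 0.

Definition P_mx : 'M[K]_(2 ^ m) := \matrix_(k, l) p_coef (vec_at k) (vec_at l).

(* A 1-form on K^m with coefficients in a K-vector space E is a function
   'rV[K]_m -> 'rV[K]_m -> E of a point x and a tangent vector h, linear in h.
   dlog g is the 1-form dg / g. *)
Definition dlog (g : 'rV[K]_m -> K) (x h : 'rV[K]_m) : K := 'd g x h / g x.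

Definition coord_fun (k : 'I_m) (x : 'rV[K]_m) : K := x 0 k.

Definition one_minus (v : Z2 m) (x : 'rV[K]_m) : K :=
  1 - \sum_i (v i)%:R * x 0 i.

Definition Xi (x h : 'rV[K]_m) : 'M[K]_(2 ^ m) :=
  \sum_(k < m) ((1 - c k) * dlog (coord_fun k) x h) *: 1%:M
  + \sum_(k < m) \sum_(v : Z2 m | ~~ v k)
      (beta true k * prod_beta v * dlog (coord_fun k) x h) *:
      (C_mx *m (f_vec v - f_vec (flip k v))^T *m (e_vec v - e_vec (flip k v)))
  + \sum_(v : Z2 m)
      (- a * prod_beta v * dlog (one_minus v) x h) *:
      (C_mx *m (f_vec v)^T *m f_vec v).

Definition poch (l : K) (n : nat) : K := \prod_(k < n) (l + k%:R).

Definition F_A_term (x : 'rV[K]_m) (n : {ffun 'I_m -> nat}) : K :=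
  poch a (\sum_i n i)%N * \prod_i poch (b i) (n i)
  / (\prod_i poch (c i) (n i) * \prod_i poch 1 (n i))
  * \prod_i x 0 i ^+ n i.

(* Unordered sum over N^m: limit of the sums over finite subsets of N^m. *)
Definition F_A (x : 'rV[K]_m) : K := summability.sum (F_A_term x).

Definition DD : set 'rV[K]_m := [set x | \sum_i `|x 0 i| < 1].

(* x_i d/dx_i *)
Definition theta (i : 'I_m) (g : 'rV[K]_m -> K) (x : 'rV[K]_m) : K :=
  x 0 i * 'D_(delta_mx 0 i) g x.

Definition theta_prod (v : Z2 m) (g : 'rV[K]_m -> K) : 'rV[K]_m -> K :=
  foldr theta g [seq i <- enum 'I_m | v i].

End Pfaffian.

Definition F_zero (R : realType) m (a : CC R) (b c : 'I_m -> CC R)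
    (x : 'rV[CC R]_m) : CC R :=
  (\prod_i (Gamma (b i) * Gamma (c i - b i) / Gamma (c i))) * F_A a b c x.

Definition F_vec (R : realType) m (a : CC R) (b c : 'I_m -> CC R)
    (x : 'rV[CC R]_m) : 'cV[CC R]_(2 ^ m) :=
  \col_k theta_prod (vec_at k) (F_zero a b c) x.

(* Main.v *)
(* Let A_n be the coefficients of F_A, theta_k = x_k d/dx_k, theta = sum_k theta_k,
   and, with F = F_(0,...,0), let
     g_w = prod_(w_i = 1) (-(theta_i + b_i) / beta_(1,i)) F.
   Then F_v = sum_w p_(vw) g_w, since P is a tensor product of 2 x 2 matrices.
   The numbers A_w satisfy gamma_w A_w = sum_(w_j = 1) A_(w - e_j), and this makes
   the product of C with the transpose of f_v telescope to e_v / Pi beta_v.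
   Hence the system for g reads
     theta_k g_v = E_k + v_k x_k / (1 - v.x) (a g_v + sum_j E_j),
     E_k = - beta_(v_k,k) g_v - beta_(1-v_k,k) g_(sigma_k.v).
   The two-term recurrence of the A_n in the k-th variable says that
     theta_k g_v = E_k + v_k x_k (theta + a) g_v;
   summing over k gives (1 - v.x) (theta + a) g_v = a g_v + sum_j E_j.

   Termwise differentiation rests on two estimates. First, |A_n| is at most
   C mu^|n| |n|! / prod_i n_i! for every mu > 1. Second, the sum s of
   |n|! / prod_i n_i! t^n over a box satisfies s <= 1 + (sum_i t_i) s by Pascal's
   rule, so it is bounded by 1 / (1 - sum_i t_i). *)
Require Import Defs.
From HB Require Import structures.
From mathcomp Require Import all_boot all_order all_algebra.
From mathcomp Require Import finmap complex.
From mathcomp Require Import all_classical all_reals all_analysis.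
From mathcomp Require Import ring.
From mathcomp Require summability.

Set Implicit Arguments.
Unset Strict Implicit.
Unset Printing Implicit Defensive.

Import Order.TTheory GRing.Theory Num.Theory.
Import numFieldNormedType.Exports.

Local Open Scope classical_set_scope.
Local Open Scope ring_scope.

(** * The matrix C and the system in the basis P^-1 F *)

Lemma vec_at_bij m : bijective (@vec_at m).
Proof.
set s := sort (fun v w => (v == w) || gt_vec w v) (enum {: Z2 m}).
have ss : size s = (2 ^ m)%N.
  by rewrite size_sort -cardE card_ffun card_bool card_ord.
have us : uniq s by rewrite sort_uniq enum_uniq.
apply: inj_card_bij => [k l /eqP|].
  by rewrite nth_uniq ?ss ?ltn_ord // => /eqP/val_inj.
by rewrite card_ffun card_bool !card_ord.
Qed.

(** Trades matrix positions for vectors of Z_2^m, over which sums of products factor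
    coordinatewise. *)
Lemma sum_vec_at m (V : nmodType) (F : Z2 m -> V) :
  \sum_(k < 2 ^ m) F (vec_at k) = \sum_v F v.
Proof. by rewrite [RHS](reindex (@vec_at m)) //; apply/onW_bij/vec_at_bij. Qed.

Lemma iota_rcons k n : iota k n.+1 = rcons (iota k n) (k + n).
Proof. by rewrite -addn1 iotaD cats1. Qed.

Lemma flipK m (j : 'I_m) : involutive (flip j).
Proof.
by move=> v; apply/ffunP => i; rewrite !ffunE; case: eqP => // _; rewrite negbK.
Qed.

Lemma flip_id m (j : 'I_m) v : flip j v j = ~~ v j.
Proof. by rewrite ffunE eqxx. Qed.

Lemma flip_ne m (j i : 'I_m) v : i != j -> flip j v i = v i.
Proof. by rewrite ffunE => /negPf ->. Qed.

(** The entrywise inequalities add up to an equality of weights, so each of them is an equality. *)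
Lemma succeq_weight_eq m (v w : Z2 m) :
  succeq v w -> weight v = weight w -> v = w.
Proof.
move=> /forallP vw evw; apply/ffunP => i.
have le i0 : true -> (w i0 <= v i0 ?= iff (w i0 == v i0))%N.
  by move=> _; have := vw i0; case: (w i0); case: (v i0).
have := (leqif_sum le).2; rewrite -/(weight v) -/(weight w) evw eqxx.
by move=> /esym/forallP/(_ i)/eqP.
Qed.

Lemma weight_flip m (w : Z2 m) j : w j -> weight w = (weight (flip j w)).+1.
Proof.
move=> wj; rewrite /weight (bigD1 j) //= [in RHS](bigD1 j) //= flip_id wj /=.
by rewrite add1n add0n; congr _.+1; apply: eq_bigr => i ij; rewrite flip_ne.
Qed.

(** The covering relation of the Boolean lattice: a weight drop of exactly one leaves room for a
    single changed coordinate. It turns steps of chains into flips. *)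
Lemma succ_strict_flipP m (w u : Z2 m) :
  reflect (exists2 j, w j & u = flip j w)
          (succ_strict w u && ((weight u).+1 == weight w)).
Proof.
apply: (iffP andP) => [[/andP[wu /forallP sub] /eqP wt]|[j wj ->]].
  have [j wuj] : exists j, w j != u j.
    by apply/existsP; apply: contraR wu; rewrite negb_exists => /forallP h;
       apply/eqP/ffunP => i; apply/eqP; rewrite -[_ == _]negbK h.
  have /andP[wj uj] : w j && ~~ u j.
    by have := sub j; move: wuj; case: (w j); case: (u j).
  exists j => //; apply/esym/succeq_weight_eq.
    apply/forallP => i; apply/implyP => ui; have [ij|ij] := eqVneq i j.
      by rewrite -ij ui in uj.
    by rewrite flip_ne // (implyP (sub i)).
  by apply/eqP; rewrite -eqSS -weight_flip // wt.
rewrite -weight_flip // eqxx; split=> //; apply/andP; split.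
  by apply/eqP => /(congr1 (fun v : Z2 m => v j)); rewrite flip_id; case: (w j).
apply/forallP => i; have [->|ij] := eqVneq i j; first by rewrite wj implybT.
by rewrite flip_ne // implybb.
Qed.

Lemma sum_succ_strict m (V : nmodType) (w : Z2 m) (G : Z2 m -> V) :
  \sum_(u | succ_strict w u && ((weight u).+1 == weight w)) G u
  = \sum_(j | w j) G (flip j w).
Proof.
transitivity (\sum_(u in [set flip j w | j : 'I_m & w j]) G u).
  apply: eq_bigl => u; apply/succ_strict_flipP/imsetP => -[j].
    by move=> wj ->; exists j; rewrite ?inE.
  by rewrite inE => wj ->; exists j.
rewrite big_imset /=; first by apply: eq_bigl => j; rewrite inE.
move=> i j; rewrite !inE => wi wj /(congr1 (fun v : Z2 m => v i)).
by rewrite flip_id wi; have [//|ij] := eqVneq i j; rewrite flip_ne // wi.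
Qed.

(** * The recursion for the numbers A_w *)

Section ChainSums.
Context {K : numClosedFieldType} {m : nat}.
Variables (a : K) (c : 'I_m -> K).

Notation gamma := (gamma a c).

(** Variant of [chain_to] whose length r is a free parameter instead of [weight w], so that
    recursion on the length avoids dependent tuple types. *)
Let chain r (w : Z2 m) (s : seq (Z2 m)) :=
  [&& path (fun u v => succ_strict v u) (zero_vec m) s,
      last (zero_vec m) s == w & map (@weight m) s == iota 1 r].

Let A r w : K :=
  \sum_(s : r.-tuple (Z2 m) | chain r w s) (\prod_(u <- s) gamma u)^-1.

Let A_coefE w : A_coef a c w = A (weight w) w.
Proof.
rewrite /A_coef /A; apply: eq_big => [s|s _]; last by rewrite big_tuple.
rewrite /chain_to /chain; congr [&& _, _ & _].
apply/forallP/eqP => [h|h j].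
  apply: (@eq_from_nth _ 0%N) => [|i]; rewrite size_map size_tuple ?size_iota //.
  move=> ir.
  rewrite (nth_map (zero_vec m)) ?size_tuple // nth_iota // add1n.
  by have /eqP := h (Ordinal ir); rewrite (tnth_nth (zero_vec m)).
have js : (j < size s)%N by rewrite size_tuple.
have /(congr1 (fun l => nth 0%N l j)) := h.
rewrite nth_iota // (nth_map (zero_vec m)) // add1n => <-.
by rewrite (tnth_nth (zero_vec m)).
Qed.

(** The last vertex of a chain is w and contributes the factor 1 / gamma_w; deleting it leaves a
    chain ending at some u covered by w. *)
Let A_rec r w : weight w = r.+1 ->
  A r.+1 w
  = (gamma w)^-1 * \sum_(u | succ_strict w u && (weight u == r)) A r u.
Proof.
move=> wr; rewrite mulr_sumr.
(* Appending a last vertex and splitting it off are mutually inverse; this reindexes chains of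
   length r + 1 by a shorter chain and an end point. *)
pose rc (p : r.-tuple (Z2 m) * Z2 m) : r.+1.-tuple (Z2 m) := [tuple of rcons p.1 p.2].
pose fr (s : r.+1.-tuple (Z2 m)) : r.-tuple (Z2 m) * Z2 m :=
  ([tuple of belast (thead s) (behead s)], last (thead s) (behead s)).
have rcK : cancel fr rc.
  move=> s; apply: val_inj; rewrite /= -lastI.
  by rewrite [in RHS](tuple_eta s).
have frK : cancel rc fr.
  move=> [s x]; rewrite /fr /rc /=.
  have e : thead (rcons_tuple s x) :: behead (rcons s x) = rcons s x.
    by rewrite -[LHS]/(val [tuple of _ :: behead (rcons_tuple s x)]) -tuple_eta.
  have := lastI (thead (rcons_tuple s x)) (behead (rcons s x)).
  rewrite e => /eqP; rewrite eqseq_rcons => /andP[/eqP es /eqP ex].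
  by congr (_, _) => //; apply: val_inj.
rewrite [LHS](reindex rc) /=; last by exists fr => ? _; [exact: frK|exact: rcK].
transitivity (\sum_(p : r.-tuple (Z2 m) * Z2 m |
    (p.2 == w) && (chain r (last (zero_vec m) p.1) p.1
                   && succ_strict w (last (zero_vec m) p.1)))
    ((gamma w)^-1 * (\prod_(u <- p.1) gamma u)^-1)).
  apply: eq_big => [[s x]|[s x]] /=.
    rewrite /chain rcons_path last_rcons map_rcons iota_rcons eqseq_rcons eqxx /=.
    have [->|] := eqVneq x w; last by rewrite andbF.
    by rewrite wr eqxx /= andbT andbAC andbA.
  rewrite /chain last_rcons => /and3P[_ /eqP -> _].
  by rewrite big_rcons invfM mulrC.
rewrite (eq_bigl (fun p : r.-tuple (Z2 m) * Z2 m =>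
    (chain r (last (zero_vec m) p.1) p.1 && succ_strict w (last (zero_vec m) p.1))
    && (p.2 == w))); last by move=> p; rewrite andbC.
rewrite -(pair_big_dep (fun s : r.-tuple (Z2 m) =>
    chain r (last (zero_vec m) s) s && succ_strict w (last (zero_vec m) s))
   (fun _ x => x == w)
   (fun s _ => (gamma w)^-1 * (\prod_(u <- s) gamma u)^-1)) /=.
under eq_bigr do rewrite big_pred1_eq.
(* Group the shortened chains by their own last vertex u. *)
rewrite (partition_big (fun s : r.-tuple (Z2 m) => last (zero_vec m) s)
   (fun u => succ_strict w u && (weight u == r))) /=; last first.
  move=> s /andP[/and3P[_ _ /eqP ws] ->] /=; apply/eqP.
  (* For r = 0 the shortened chain is empty, and the default [zero_vec m] of [last] has weight 0 as
     required. *)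
  rewrite -(last_map (@weight m)) ws; case: (r) => [|k].
    by rewrite /weight big1 // => i _; rewrite ffunE.
  by rewrite iota_rcons last_rcons.
apply: eq_bigr => u /andP[wu _]; rewrite mulr_sumr; apply: eq_bigl => s.
rewrite /chain eqxx /=; have [->|] := eqVneq (last _ s) u; last by rewrite !andbF.
by rewrite wu !andbT.
Qed.

Lemma A_coef0 : A_coef a c (zero_vec m) = 1.
Proof.
have w0 : weight (zero_vec m) = 0%N.
  by rewrite /weight big1 // => i _; rewrite ffunE.
rewrite A_coefE w0 /A (big_pred1 [tuple]) ?big_nil ?invr1 // => s.
by rewrite tuple0 /chain /= !eqxx.
Qed.

Lemma A_coef_rec w : w != zero_vec m -> gamma w != 0 ->
  gamma w * A_coef a c w = \sum_(j | w j) A_coef a c (flip j w).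
Proof.
move=> w0 gw; rewrite -sum_succ_strict.
have [j wj] : exists j, w j.
  apply/existsP; apply: contraR w0; rewrite negb_exists => /forallP h.
  by apply/eqP/ffunP => i; rewrite ffunE; apply/negbTE.
rewrite A_coefE (weight_flip wj) A_rec ?(weight_flip wj) // mulrA mulfV // mul1r.
apply: eq_big => u; rewrite ?(weight_flip wj) ?eqSS //.
by move=> /andP[_ /eqP <-]; rewrite A_coefE.
Qed.

End ChainSums.

(** * The product of C with the transpose of f_v, and the inverse of P *)

Section IntersectionMatrix.
Context {K : numClosedFieldType} {m : nat}.
Variables (a : K) (b c : 'I_m -> K).
Hypothesis a0 : a != 0.
Hypothesis beta0 : forall e i, beta b c e i != 0.
Hypothesis gamma0 : forall v, gamma a c v != 0.

Notation beta := (beta b c).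
Notation gamma := (gamma a c).
Notation A_coef := (A_coef a c).

Definition f_entry (v u : Z2 m) : K :=
  (a - sum_beta b c v) / a * (u == v)%:R
  - \sum_j beta (~~ v j) j / a * (u == flip j v)%:R.

Lemma f_vecE v k : f_vec a b c v 0 k = f_entry v (vec_at k).
Proof.
rewrite /f_vec /f_entry !mxE; congr (_ - _).
by rewrite summxE; apply: eq_bigr => j _; rewrite !mxE.
Qed.

(** The product attached to w in C_(v,u). It sees u only through the coordinates outside the support
    of w, which gives the two flip rules below. *)
Let T (v w u : Z2 m) : K := \prod_(i | ~~ w i) ((v i == u i)%:R / beta (v i) i).

Let sum_delta (G : Z2 m -> K) (v : Z2 m) : \sum_u G u * (u == v)%:R = G v.
Proof.
rewrite (bigD1 v) //= eqxx mulr1 big1 ?addr0 // => u /negPf ->.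
by rewrite mulr0.
Qed.

Let T_flip_in (v w u : Z2 m) j : w j -> T v w (flip j u) = T v w u.
Proof.
move=> wj; apply: eq_bigr => i wi; rewrite flip_ne //.
by apply: contraNneq wi => ->.
Qed.

(** Summing over both values of u_j with weights beta cancels the j-th factor, since exactly one
    value equals v_j; the remaining product is the one attached to w + e_j. *)
Let T_flip_out (v w u : Z2 m) j : ~~ w j ->
  beta (~~ u j) j * T v w (flip j u) = T v (flip j w) u - beta (u j) j * T v w u.
Proof.
move=> wj; rewrite /T (bigD1 j) //= [X in _ = _ - _ * X](bigD1 j) //= flip_id.
have e : \prod_(i | ~~ w i && (i != j)) ((v i == flip j u i)%:R / beta (v i) i)
       = \prod_(i | ~~ w i && (i != j)) ((v i == u i)%:R / beta (v i) i).
  by apply: eq_bigr => i /andP[_ ij]; rewrite flip_ne.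
have -> : \prod_(i | ~~ flip j w i) ((v i == u i)%:R / beta (v i) i)
       = \prod_(i | ~~ w i && (i != j)) ((v i == u i)%:R / beta (v i) i).
  apply: eq_bigl => i; have [->|ij] := eqVneq i j.
    by rewrite flip_id negbK (negPf wj).
  by rewrite flip_ne // andbT.
rewrite e; set X := \prod_(i | _) _; have := beta0 (v j) j.
case: (v j) (u j) => [] [] /= h; field; exact: h.
Qed.

(** Rests on beta_(0,j) + beta_(1,j) = c_j - 1. *)
Let gamma_sum (w : Z2 m) : gamma w = a - \sum_(j | w j) (beta true j + beta false j).
Proof.
rewrite /Defs.gamma /weight natr_sum -addrA; congr (_ + _).
rewrite -[RHS]mulN1r mulr_sumr [RHS]big_mkcond -sumrN -big_split /=.
by apply: eq_bigr => i _; rewrite /Defs.beta; case: (w i) => /=; ring.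
Qed.

(** This is a f_(v') applied to T(v,w,.). Inside the support of w both betas of a coordinate are
    subtracted from a, leaving gamma_w; outside it the diagonal beta cancels and w grows by e_j. *)
Let bracket (v w v' : Z2 m) :
  (a - sum_beta b c v') * T v w v' - \sum_j beta (~~ v' j) j * T v w (flip j v')
  = gamma w * T v w v' - \sum_(j | ~~ w j) T v (flip j w) v'.
Proof.
rewrite gamma_sum /sum_beta (bigID w) /= [X in _ - X](bigID w) /=.
rewrite [X in _ - (X + _) = _](eq_bigr (fun j => beta (~~ v' j) j * T v w v')); last first.
  by move=> j wj; rewrite T_flip_in.
rewrite -mulr_suml [X in _ - (_ + X) = _](eq_bigr (fun j =>
  T v (flip j w) v' - beta (v' j) j * T v w v')); last first.
  by move=> j wj; rewrite T_flip_out.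
rewrite sumrB -mulr_suml.
have -> : \sum_(j | w j) (beta true j + beta false j)
        = \sum_(j | w j) beta (v' j) j + \sum_(j | w j) beta (~~ v' j) j.
  rewrite -big_split; apply: eq_bigr => j _ /=.
  by case: (v' j) => //=; rewrite addrC.
ring.
Qed.

(* The sum over w telescopes: by the recursion for A_w, the term at w <> 0
   cancels against the terms at w - e_j shifted by e_j. *)
Lemma C_coef_f_entry (v v' : Z2 m) :
  \sum_u C_coef a b c v u * f_entry v' u = (prod_beta b c v')^-1 * (v == v')%:R.
Proof.
rewrite /f_entry; under eq_bigr do rewrite mulrBr mulrA mulr_sumr.
rewrite sumrB sum_delta exchange_big /=.
under [X in _ - X]eq_bigr do under eq_bigr do rewrite mulrA.
under [X in _ - X]eq_bigr do rewrite sum_delta.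
apply: (mulfI a0); rewrite mulrBr mulr_sumr.
transitivity (\sum_(w : Z2 m) A_coef w * (gamma w * T v w v'
                                 - \sum_(j | ~~ w j) T v (flip j w) v')).
  under [RHS]eq_bigr do rewrite -bracket mulrBr mulr_sumr.
  rewrite sumrB exchange_big /=; congr (_ - _).
    rewrite /C_coef mulr_suml mulr_sumr; apply: eq_bigr => w _.
    rewrite -/(T v w v'); move: (T v w v') (A_coef w) => X Y; field; exact: a0.
  apply: eq_bigr => j _; rewrite /C_coef mulr_suml mulr_sumr.
  apply: eq_bigr => w _; rewrite -/(T v w (flip j v')).
  move: (T v w _) (A_coef w) => X Y; field; exact: a0.
under eq_bigr do rewrite mulrBr mulr_sumr.
rewrite sumrB.
have -> : \sum_(w : Z2 m) \sum_(j | ~~ w j) A_coef w * T v (flip j w) v'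
        = \sum_(w : Z2 m) (\sum_(j | w j) A_coef (flip j w)) * T v w v'.
  under [RHS]eq_bigr do rewrite mulr_suml.
  rewrite [LHS](exchange_big_dep predT) //= [RHS](exchange_big_dep predT) //=.
  apply: eq_bigr => j _; rewrite [RHS](reindex (flip j)) /=; last first.
    by apply: onW_bij; exists (flip j); exact: flipK.
  by apply: eq_big => w; rewrite ?flip_id // flipK.
(* Only w = 0 survives, where A_w = 1, gamma_w = a and T is delta(v,v') / Pi beta_v. *)
rewrite (bigD1 (zero_vec m)) //= [X in _ - X](bigD1 (zero_vec m)) //=.
rewrite [X in _ - (X * _ + _)]big1 => [|j]; last by rewrite ffunE.
rewrite [X in _ - (_ + X)](eq_bigr (fun w : Z2 m => A_coef w * (gamma w * T v w v'))).
  rewrite mul0r add0r addrK A_coef0 mul1r gamma_sum big1 => [|j]; last by rewrite ffunE.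
  rewrite subr0; congr (_ * _); rewrite /T.
  rewrite (eq_bigl predT) => [|i]; last by rewrite ffunE.
  have [->|vv'] := eqVneq v v'.
    rewrite mulr1 /prod_beta -prodfV; apply: eq_bigr => i _.
    by rewrite eqxx mul1r.
  rewrite mulr0; apply/eqP/prodf_eq0.
  have /existsP[i vi] : [exists i, v i != v' i].
    by apply: contraR vv'; rewrite negb_exists => /forallP h;
       apply/eqP/ffunP => i; apply/eqP; rewrite -[_ == _]negbK h.
  by exists i => //; rewrite (negPf vi) mul0r.
by move=> w w0; rewrite -A_coef_rec //; ring.
Qed.

Lemma C_mx_f_vec v :
  C_mx a b c *m (f_vec a b c v)^T = (prod_beta b c v)^-1 *: (e_vec v)^T.
Proof.
apply/matrixP => k l; rewrite !mxE ord1.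
transitivity (\sum_j C_coef a b c (vec_at k) (vec_at j) * f_entry v (vec_at j)).
  by apply: eq_bigr => j _; rewrite mxE [X in _ * X]mxE f_vecE.
by rewrite (sum_vec_at (fun u => C_coef a b c (vec_at k) u * f_entry v u)) C_coef_f_entry.
Qed.

(** The 2 x 2 block at coordinate i, row e and column e', of which P is the tensor product. *)
Definition t_factor (e e' : bool) i : K := if e then - beta e' i else (~~ e')%:R.

(** The inverse of the block [t_factor], with rows (1, 0) and (-beta_0/beta_1, -1/beta_1). *)
Definition s_factor (e e' : bool) i : K :=
  if e then (if e' then - (beta true i)^-1 else - beta false i / beta true i)
  else (~~ e')%:R.

Lemma p_coefE v w : p_coef b c v w = \prod_i t_factor (v i) (w i) i.
Proof.
rewrite /p_coef; case: ifP => [/forallP vw|/negbT].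
  rewrite big_mkcond; apply: eq_bigr => i _; rewrite /t_factor.
  by have := vw i; case: (v i); case: (w i).
rewrite negb_forall => /existsP[j]; rewrite negb_imply => /andP[wj vj].
by apply/esym/eqP/prodf_eq0; exists j => //; rewrite /t_factor (negPf vj) wj.
Qed.

(** Tensor products multiply blockwise. Serves both the inversion of P and the identity F = P g on
    coefficients. *)
Lemma sum_prod_factor (s t : bool -> 'I_m -> K) :
  \sum_(w : Z2 m) (\prod_i s (w i) i) * (\prod_i t (w i) i)
  = \prod_i (s true i * t true i + s false i * t false i).
Proof.
rewrite (eq_bigr (fun w : Z2 m => \prod_i (s (w i) i * t (w i) i))); last first.
  by move=> w _; rewrite big_split.
rewrite -(bigA_distr_bigA (fun i e => s e i * t e i)).
by apply: eq_bigr => i _; rewrite big_bool.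
Qed.

Definition P_inv : 'M[K]_(2 ^ m) :=
  \matrix_(k, l) \prod_i s_factor (vec_at k i) (vec_at l i) i.

Lemma P_invP : P_inv *m P_mx b c = 1%:M.
Proof.
apply/matrixP => k l; rewrite !mxE.
transitivity (\sum_j (\prod_i s_factor (vec_at k i) (vec_at j i) i) *
                     (\prod_i t_factor (vec_at j i) (vec_at l i) i)).
  by apply: eq_bigr => j _; rewrite !mxE p_coefE.
rewrite (sum_vec_at (fun u : Z2 m => (\prod_i s_factor (vec_at k i) (u i) i) *
                     (\prod_i t_factor (u i) (vec_at l i) i))).
rewrite (sum_prod_factor (fun e i => s_factor (vec_at k i) e i)
  (fun e i => t_factor e (vec_at l i) i)).
transitivity (\prod_i (vec_at k i == vec_at l i :> bool)%:R : K).
  apply: eq_bigr => i _; rewrite /s_factor /t_factor; have := beta0 true i.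
  by case: (vec_at k i); case: (vec_at l i) => /= h; field.
have [->|kl] := eqVneq k l; first by rewrite big1 // => i _; rewrite eqxx.
apply/eqP/prodf_eq0.
have /existsP[i vi] : [exists i, vec_at k i != vec_at l i].
  apply: contraR kl; rewrite negb_exists => /forallP h.
  apply/eqP/(bij_inj (@vec_at_bij m))/ffunP => i.
  by apply/eqP; rewrite -[_ == _]negbK h.
by exists i => //; rewrite (negPf vi).
Qed.

Lemma P_mx_unit : P_mx b c \in unitmx.
Proof. by have [] := mulmx1_unit P_invP. Qed.

End IntersectionMatrix.

Local Arguments Defs.beta : simpl never.

(** * The connection matrix applied to a vector *)

Section XiAction.
Context {K : numClosedFieldType} {m : nat}.
Variables (a : K) (b c : 'I_m -> K).
Hypothesis a0 : a != 0.
Hypothesis beta0 : forall e i, beta b c e i != 0.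
Hypothesis gamma0 : forall v, gamma a c v != 0.

Notation beta := (beta b c).

(** The quantity E_k of the system satisfied by g. *)
Definition edge (g : Z2 m -> K) (k : 'I_m) (v : Z2 m) : K :=
  - (beta (v k) k * g v + beta (~~ v k) k * g (flip k v)).

Variable g : Z2 m -> K.
Let G : 'cV[K]_(2 ^ m) := \col_k g (vec_at k).

Let e_vec_mul v : e_vec v *m G = (g v)%:M.
Proof.
apply/matrixP => i j; rewrite !mxE !ord1 eqxx mulr1n.
rewrite (eq_bigr (fun k => (vec_at k == v)%:R * g (vec_at k))); last first.
  by move=> k _; rewrite !mxE.
rewrite (sum_vec_at (fun u => (u == v)%:R * g u)).
rewrite (bigD1 v) //= eqxx mul1r big1 ?addr0 // => u /negPf ->.
by rewrite mul0r.
Qed.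

Let f_vec_mul v :
  f_vec a b c v *m G = ((a * g v + \sum_k edge g k v) / a)%:M.
Proof.
rewrite /f_vec mulmxBl -scalemxAl e_vec_mul mulmx_suml.
under eq_bigr do rewrite -scalemxAl e_vec_mul.
apply/matrixP => i j; rewrite !ord1 !mxE summxE eqxx !mulr1n.
under eq_bigr do rewrite !mxE eqxx mulr1n mulrAC.
rewrite -mulr_suml mulrAC -mulrBl; congr (_ / a).
rewrite /edge sumrN big_split /= opprD addrA mulrBl; congr (_ - _ - _).
by rewrite mulr_suml.
Qed.

Let prod_beta_flip v k :
  prod_beta b c (flip k v) * beta (v k) k = prod_beta b c v * beta (~~ v k) k.
Proof.
rewrite /prod_beta (bigD1 k) //= [in RHS](bigD1 k) //= flip_id.
rewrite (eq_bigr (fun i => beta (v i) i)) => [|i ik]; last by rewrite flip_ne.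
ring.
Qed.

Let prod_beta0 v : prod_beta b c v != 0.
Proof. by apply/prodf_neq0 => i _; apply: beta0. Qed.

(** In row u a single v contributes: u itself if u_k = 0, and sigma_k.u if u_k = 1. Both cases give
    the same expression because c_k - 1 = beta_(0,k) + beta_(1,k). *)
Let edge_term (d : K) k (u : Z2 m) :
  \sum_(v : Z2 m | ~~ v k) beta true k * prod_beta b c v * d
     * ((prod_beta b c v)^-1 * (u == v)%:R
        - (prod_beta b c (flip k v))^-1 * (u == flip k v)%:R)
     * (g v - g (flip k v))
  = d * (edge g k u - (1 - c k) * g u).
Proof.
have [uk|uk] := boolP (u k).
  rewrite (bigD1 (flip k u)) /=; last by rewrite flip_id uk.
  rewrite flipK eqxx big1 => [|v /andP[vk vu]]; last first.
    rewrite (negPf (_ : u != v)); last by apply: contraNneq vk => <-.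
    rewrite (negPf (_ : u != flip k v)) ?(mulr0, mul0r, subr0) //.
    by apply: contraNneq vu => ->; rewrite flipK.
  rewrite (negPf (_ : u != flip k u)); last first.
    by apply/eqP => /(congr1 (fun v : Z2 m => v k)); rewrite flip_id uk.
  have := prod_beta_flip u k; rewrite /edge uk [~~ true]/= => e.
  have -> : prod_beta b c (flip k u) = prod_beta b c u * beta false k / beta true k.
    by rewrite -e mulfK.
  have := prod_beta0 u; have := beta0 true k; have := beta0 false k.
  have -> : c k = beta true k + beta false k + 1 by rewrite /Defs.beta; ring.
  move: (beta true k) (beta false k) (prod_beta b c u) => x y z /= h1 h2 h3.
  by field; rewrite h2 h3.
rewrite (bigD1 u) //= eqxx big1 => [|v /andP[vk vu]]; last first.
  rewrite eq_sym (negPf vu) (negPf (_ : u != flip k v)).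
    by rewrite ?(mulr0, mul0r, subr0).
  by apply/eqP => e; move: uk; rewrite e flip_id vk.
rewrite (negPf (_ : u != flip k u)); last first.
  by apply/eqP => /(congr1 (fun v : Z2 m => v k)); rewrite flip_id; case: (u k).
rewrite /edge (negPf uk) [~~ false]/=.
have -> : c k = beta true k + beta false k + 1 by rewrite /Defs.beta; ring.
have := prod_beta0 u; have := prod_beta0 (flip k u).
move: (prod_beta b c u) (prod_beta _ _ _) => z z2 /= h h2.
by field; rewrite h h2.
Qed.

(* On the columns C ^t(f_v) = e_v / prod_beta v the residue matrices collapse,
   and the diagonal terms (1 - c_k) are absorbed by beta_0k + beta_1k = c_k - 1. *)
Lemma Xi_mul x h : Xi a b c x h *m G
  = \col_k (\sum_j dlog (coord_fun j) x h * edge g j (vec_at k)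
            - dlog (one_minus (vec_at k)) x h
              * (a * g (vec_at k) + \sum_j edge g j (vec_at k))).
Proof.
have Cf v i : (C_mx a b c *m (f_vec a b c v)^T) i 0
              = (prod_beta b c v)^-1 * (vec_at i == v)%:R.
  by rewrite C_mx_f_vec // !mxE.
have CfB v u i : (C_mx a b c *m (f_vec a b c v - f_vec a b c u)^T) i 0
    = (prod_beta b c v)^-1 * (vec_at i == v)%:R
      - (prod_beta b c u)^-1 * (vec_at i == u)%:R.
  by rewrite linearB /= mulmxBr mxE [X in _ + X]mxE !Cf.
apply/matrixP => i j0; rewrite !ord1 /Xi !mulmxDl !mulmx_suml mxE [X in X + _]mxE.
rewrite !summxE mxE; congr (_ + _).
  rewrite -big_split /=; apply: eq_bigr => k _.
  rewrite -scalemxAl mul1mx mxE [G i 0]mxE mulmx_suml summxE.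
  rewrite [X in _ + X](eq_bigr (fun v =>
     beta true k * prod_beta b c v * dlog (coord_fun k) x h
     * ((prod_beta b c v)^-1 * (vec_at i == v)%:R
        - (prod_beta b c (flip k v))^-1 * (vec_at i == flip k v)%:R)
     * (g v - g (flip k v)))).
    by rewrite edge_term; ring.
  move=> v _; rewrite -scalemxAl mxE -mulmxA mulmxBl !e_vec_mul -raddfB /=.
  rewrite mul_mx_scalar mxE CfB; ring.
(* In the third sum the column C ^t(f_v) is supported at v, so row i keeps only v = [vec_at i]. *)
rewrite (bigD1 (vec_at i)) //= big1 => [|v vi]; last first.
  rewrite -scalemxAl mxE -mulmxA f_vec_mul mul_mx_scalar mxE Cf eq_sym (negPf vi).
  by rewrite !mulr0.
rewrite addr0 -scalemxAl mxE -mulmxA f_vec_mul mul_mx_scalar mxE Cf eqxx.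
have := prod_beta0 (vec_at i); move: (prod_beta b c _) (dlog _ _ _) => z d /= h0.
by field; rewrite a0 h0.
Qed.

End XiAction.

(** * Unordered sums *)

(** The epsilon form of convergence over finite subsets, available over the reals and over [CC R]
    alike; in the latter 0 < e makes e real. *)
Definition has_sum (I : choiceType) (K : numDomainType) (f : I -> K) (l : K) :=
  forall e, 0 < e -> exists S0 : {fset I}, forall S : {fset I},
    (S0 `<=` S)%fset -> `|\sum_(i <- S) f i - l| < e.

Lemma has_sumP (I : choiceType) (K : numClosedFieldType) (f : I -> K) l :
  has_sum f l -> summability.sum f = l.
Proof.
have FF := @summability.totally_filter I.
move=> fl; apply: cvg_lim; first exact: norm_hausdorff.
apply/cvgrPdist_lt => e e0; have [S0 hS0] := fl _ e0.
exists S0 => // S /= SS; rewrite distrC /summability.partial_sum.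
by rewrite -(big_seq_fsetE _ S predT f) hS0.
Qed.

Section HasSum.
Context {I : choiceType} {K : numFieldType}.
Implicit Types (f g : I -> K) (S : {fset I}).

Lemma has_sumD f g l k : has_sum f l -> has_sum g k ->
  has_sum (fun i => f i + g i) (l + k).
Proof.
move=> fl gk e e0; have e2 : 0 < e / 2 by rewrite divr_gt0 ?ltr0n.
have [S1 h1] := fl _ e2; have [S2 h2] := gk _ e2.
exists (S1 `|` S2)%fset => S; rewrite fsubUset => /andP[/h1 b1 /h2 b2].
rewrite big_split /= opprD addrACA; apply: le_lt_trans (ler_normD _ _) _.
by rewrite [ltRHS](splitr e) ltrD.
Qed.

Lemma has_sum0 : has_sum (fun _ : I => 0 : K) 0.
Proof. by move=> e e0; exists fset0 => S _; rewrite big1 // subr0 normr0. Qed.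

Lemma has_sumZ x f l : has_sum f l -> has_sum (fun i => x * f i) (x * l).
Proof.
move=> fl e e0; have [->|x0] := eqVneq x 0.
  by exists fset0 => S _; rewrite big1 => [|i _]; rewrite mul0r // subr0 normr0.
have nx : 0 < `|x| by rewrite normr_gt0.
have [S0 h] := fl _ (divr_gt0 e0 nx); exists S0 => S /h.
by rewrite ltr_pdivlMr // mulrC -normrM mulrBr mulr_sumr.
Qed.

Lemma has_sum_big (J : Type) (r : seq J) (P : pred J) (f : J -> I -> K) l :
  (forall j, P j -> has_sum (f j) (l j)) ->
  has_sum (fun i => \sum_(j <- r | P j) f j i) (\sum_(j <- r | P j) l j).
Proof.
move=> fl; elim: r => [|j r IH].
  under [fun i => _]funext do rewrite big_nil.
  by rewrite big_nil; exact: has_sum0.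
under [fun i => _]funext do rewrite big_cons.
by rewrite big_cons; case: ifP => // Pj; exact/has_sumD/IH/fl.
Qed.

Lemma has_sum_unique f l k : has_sum f l -> has_sum f k -> l = k.
Proof.
move=> fl fk; apply/eqP; rewrite -subr_eq0 -normr_le0; apply/ler_addgt0Pl => e e0.
have e2 : 0 < e / 2 by rewrite divr_gt0 ?ltr0n.
have [S1 h1] := fl _ e2; have [S2 h2] := fk _ e2.
have := h1 _ (fsubsetUl S1 S2); have := h2 _ (fsubsetUr S1 S2).
move: (\sum_(i <- _) _) => s b2 b1; rewrite addr0.
have -> : l - k = (s - k) - (s - l) by ring.
apply: le_trans (ler_normB _ _) _.
by rewrite [leRHS](splitr e) lerD // ltW.
Qed.

Lemma has_sum_le f l B :
  has_sum f l -> (forall S, `|\sum_(i <- S) f i| <= B) -> `|l| <= B.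
Proof.
move=> fl fB; apply/ler_addgt0Pl => e /fl[S0 /(_ _ (fsubset_refl _))/ltW h].
have -> : l = \sum_(i <- S0) f i - (\sum_(i <- S0) f i - l) by rewrite subKr.
by apply: le_trans (ler_normB _ _) _; rewrite addrC lerD.
Qed.

Lemma has_sum_reindex (J : choiceType) (h : J -> I) (g : I -> J) f l :
  cancel h g -> (forall i, f i != 0 -> h (g i) = i) ->
  has_sum (f \o h) l -> has_sum f l.
Proof.
move=> hK fg fl e /fl[S0 hS0]; exists [fset h j | j in S0]%fset => S sub.
(* Indices outside the image of h are discarded; f vanishes there. *)
pose S1 := [fset i in S | h (g i) == i]%fset.
have -> : \sum_(i <- S) f i = \sum_(j <- [fset g i | i in S1]%fset) (f \o h) j.
  rewrite big_imfset /=; last first.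
    by move=> i j; rewrite !inE => /andP[_ /eqP {2}<-] /andP[_ /eqP {2}<-] ->.
  rewrite big_fset /= [RHS]big_mkcond; apply: eq_bigr => i _.
  by case: eqP => [->|/eqP] //; apply: contraNeq => /fg ->.
apply: hS0; apply/fsubsetP => j jS; apply/imfsetP; exists (h j) => //=.
by rewrite !inE hK eqxx andbT (fsubsetP sub) // in_imfset.
Qed.

End HasSum.

Lemma ler_sum_fset (K : numDomainType) (I : choiceType) (f : I -> K)
    (S T : {fset I}) :
  (forall i, 0 <= f i) -> (S `<=` T)%fset ->
  \sum_(i <- S) f i <= \sum_(i <- T) f i.
Proof.
move=> f0 /fsubsetP ST; rewrite [leRHS](big_fsetID _ (mem S)) /=.
rewrite (_ : \sum_(i <- [fset x | x in T & x \in S]%fset) f i = \sum_(i <- S) f i).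
  by rewrite lerDl sumr_ge0.
by apply: eq_fbigl => i; rewrite !inE andbC; case: (boolP (i \in S)) => // /ST ->.
Qed.

Lemma has_sum_ge0 (R : realType) (I : choiceType) (f : I -> R) B :
  (forall i, 0 <= f i) -> (forall S : {fset I}, \sum_(i <- S) f i <= B) ->
  exists l, has_sum f l.
Proof.
move=> f0 fB; pose E : set R := range (fun S : {fset I} => \sum_(i <- S) f i).
have hE : has_sup E.
  split; first by exists (\sum_(i <- fset0 : {fset I}) f i); exists fset0.
  by exists B => _ [S _ <-].
(* Finite sums of a nonnegative family increase with the set, so they converge to their supremum. *)
exists (sup E) => e e0; have [_ [S0 _ <-] h] := sup_adherent e0 hE.
exists S0 => S sub; rewrite distrC ger0_norm; last first.
  by rewrite subr_ge0 ub_le_sup //; [case: hE|exists S].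
rewrite ltrBlDl -ltrBlDr; apply: lt_le_trans h _.
exact: ler_sum_fset.
Qed.

(** Writes f as (f + |f|) - |f|, a difference of two nonnegative families with bounded sums. *)
Lemma has_sum_real (R : realType) (I : choiceType) (f : I -> R) B :
  (forall S : {fset I}, \sum_(i <- S) `|f i| <= B) -> exists l, has_sum f l.
Proof.
move=> fB; have [i|S|l hl] := @has_sum_ge0 R I (fun i => f i + `|f i|) (B + B).
- by rewrite -lerBlDr sub0r lerNl -normrN ler_norm.
- rewrite big_split lerD //; apply: le_trans (fB S).
  by apply: ler_sum => i _; exact: ler_norm.
have [i|S|k hk] := @has_sum_ge0 R I (fun i => `|f i|) B; rewrite ?normr_ge0 //.
exists (l + -1 * k).
rewrite (_ : f = fun i => f i + `|f i| + -1 * `|f i|); first exact/has_sumD/has_sumZ.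
by apply/funext => i; rewrite mulN1r addrK.
Qed.

Lemma has_sum_real_complex (R : realType) (I : choiceType) (f : I -> R) l :
  has_sum f l -> has_sum (fun i => (f i)%:C%C : CC R) (l%:C%C : CC R).
Proof.
move=> fl e; rewrite /CC ltcE => /andP[/eqP /= ime ree]; have [S0 h] := fl _ ree.
exists S0 => S /h; rewrite -rmorph_sum -rmorphB /= normc_def /= expr0n addr0.
by rewrite sqrtr_sqr ltcE /= ime eqxx.
Qed.

Lemma has_sum_complex (R : realType) (I : choiceType) (f : I -> CC R) B :
  (forall S : {fset I}, \sum_(i <- S) `|f i| <= B) -> exists l, has_sum f l.
Proof.
move=> fB.
have part (p : CC R -> R) : (forall z, `|p z|%:C%C <= `|z| :> CC R) ->
    exists l, has_sum (fun i => p (f i)) l.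
  move=> hp; apply: (@has_sum_real _ _ _ (complex.Re B)) => S.
  have : \sum_(i <- S) (`|p (f i)|%:C%C : CC R) <= B.
    by apply: le_trans (fB S); apply: ler_sum => i _.
  by rewrite -rmorph_sum /CC lecE => /andP[_].
have [k hk] := part (@complex.Re R) (@normc_ge_Re R).
have [l hl] : exists l, has_sum (fun i => complex.Im (f i)) l.
  (* Im z is minus the real part of iz, so the bound for real parts applies. *)
  apply: part => z; have := @normc_ge_Re R (z * 'i%C).
  rewrite ReiNIm normrN normrM (_ : `|'i%C| = 1 :> R[i]%C) ?mulr1 //.
  by rewrite normc_def /= expr0n expr1n add0r sqrtr1.
exists ((k%:C)%C + 'i%C * (l%:C)%C).
rewrite (_ : f = fun i => ((complex.Re (f i))%:C)%C + 'i%C * ((complex.Im (f i))%:C)%C).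
  apply: has_sumD; first exact: has_sum_real_complex.
  by apply: has_sumZ; exact: has_sum_real_complex.
by apply/funext => i; exact: complexE.
Qed.

(** * Growth of the coefficients *)

Lemma CC_archimedean (R : realType) (x : CC R) : exists n : nat, `|x| < n%:R.
Proof.
rewrite /CC normc_def; set r := Num.sqrt _; exists (Num.bound r).
rewrite -(rmorph_nat (real_complex R)) ltcR.
by apply: le_lt_trans (archi_boundP _); rewrite ?sqrtr_ge0.
Qed.

Lemma poch1 (K : numClosedFieldType) n : poch 1 n = (n`!)%:R :> K.
Proof.
elim: n => [|n IH]; first by rewrite /poch big_ord0.
by rewrite /poch big_ord_recr /= -/(poch 1 n) IH nat1r -natrM mulnC factS.
Qed.

Lemma pochS (K : numClosedFieldType) (l : K) n : poch l n.+1 = poch l n * (l + n%:R).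
Proof. by rewrite /poch big_ord_recr. Qed.

Section Growth.
Context {K : numClosedFieldType}.
Hypothesis archi : forall x : K, exists n : nat, `|x| < n%:R.

(** The quotient q of the two sides stops increasing once |b + n| <= mu |c + n|, hence is bounded by
    the sum of its first values. *)
Lemma poch_growth (b c mu : K) : (forall n : nat, c != - n%:R) -> 1 < mu ->
  exists2 C, 0 <= C & forall n, `|poch b n| <= C * mu ^+ n * `|poch c n|.
Proof.
move=> cn mu1; have mu0 : 0 < mu by exact: lt_trans mu1.
have m10 : 0 < mu - 1 by rewrite subr_gt0.
have c0 n : 0 < `|c + n%:R| by rewrite normr_gt0 addr_eq0.
have pc0 n : 0 < `|poch c n|.
  by rewrite normr_gt0; apply/prodf_neq0 => i _; rewrite -normr_gt0.
(* N comes from solving |b - c| <= (mu - 1) (n - |c|) for n. *)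
have [N hN] := archi (`|c| + `|b - c| / (mu - 1)).
rewrite ger0_norm in hN; last by rewrite addr_ge0 // divr_ge0 // ltW.
have step n : (N <= n)%N -> `|b + n%:R| <= mu * `|c + n%:R|.
  move=> Nn; have -> : b + n%:R = (b - c) + (c + n%:R) by ring.
  apply: le_trans (ler_normD _ _) _; rewrite -lerBrDr -[X in _ <= _ - X]mul1r -mulrBl.
  rewrite mulrC -ler_pdivrMr //.
  have : n%:R - `|c| <= `|c + n%:R|.
    have e : (n%:R : K) = (c + n%:R) - c by ring.
    by rewrite lerBlDr -[leLHS]ger0_norm ?ler0n // {1}e ler_normB.
  apply: le_trans; rewrite lerBrDl; apply: le_trans (ltW hN) _.
  by rewrite ler_nat.
pose q n := `|poch b n| / (mu ^+ n * `|poch c n|).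
have q0 n : 0 <= q n by rewrite divr_ge0 // mulr_ge0 // exprn_ge0 // ltW.
have qS n : (N <= n)%N -> q n.+1 <= q n.
  move=> Nn; rewrite /q !pochS !normrM ler_pdivrMr ?mulr_gt0 ?exprn_gt0 // exprS.
  have -> : `|poch b n| / (mu ^+ n * `|poch c n|)
              * (mu * mu ^+ n * (`|poch c n| * `|c + n%:R|))
          = `|poch b n| * (mu * `|c + n%:R|).
    by field; rewrite expf_neq0 ?gt_eqF.
  by rewrite ler_wpM2l // step.
exists (\sum_(k < N.+1) q k) => [|n]; first exact: sumr_ge0.
rewrite -mulrA -ler_pdivrMr ?mulr_gt0 ?exprn_gt0 // -/(q n).
have le_sum k : (k <= N)%N -> q k <= \sum_(j < N.+1) q j.
  by move=> kN; rewrite (bigD1 (Ordinal (kN : (k < N.+1)%N))) //= lerDl sumr_ge0.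
have [nN|/ltnW Nn] := leqP n N; first exact: le_sum.
elim: n Nn => [|n IH]; first by move=> _; exact: le_sum.
by rewrite leq_eqVlt => /predU1P[<-|Nn]; [exact: le_sum|apply: le_trans (qS _ _) (IH _)].
Qed.

End Growth.

(** * Multinomial coefficients and the bound on their generating series *)

Section Multinomial.
Context {K : numFieldType} {m : nat}.
Implicit Types (n : {ffun 'I_m -> nat}) (t : 'I_m -> K).

Definition deg n := (\sum_i n i)%N.

Definition monom t n : K := \prod_i t i ^+ n i.

Definition multinom n : K := (deg n)`!%:R / \prod_i (n i)`!%:R.

Definition incr (k : 'I_m) n : {ffun 'I_m -> nat} :=
  [ffun i => (n i + (i == k))%N].

(** The subtraction is truncated: [decr k n] is n when n_k = 0, whence the guards [0 < n k]
    below. *)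
Definition decr (k : 'I_m) n : {ffun 'I_m -> nat} :=
  [ffun i => (n i - (i == k))%N].

Lemma incrK k : cancel (incr k) (decr k).
Proof. by move=> n; apply/ffunP => i; rewrite !ffunE addnK. Qed.

Lemma decrK k n : (0 < n k)%N -> incr k (decr k n) = n.
Proof.
move=> nk; apply/ffunP => i; rewrite !ffunE subnK //.
by have [->|] := eqVneq i k.
Qed.

Lemma deg_incr k n : deg (incr k n) = (deg n).+1.
Proof.
rewrite /deg (eq_bigr (fun i => n i + (i == k))%N) => [|i _]; last by rewrite ffunE.
rewrite big_split /= -addn1; congr addn.
by rewrite (bigD1 k) //= eqxx big1 // => i /negPf ->.
Qed.

Lemma prod_incr (G : 'I_m -> nat -> K) k n :
  (forall i j, G i j != 0) ->
  \prod_i G i (incr k n i) = \prod_i G i (n i) * (G k (n k).+1 / G k (n k)).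
Proof.
move=> G0; rewrite (bigD1 k) //= [in RHS](bigD1 k) //= ffunE eqxx addn1.
rewrite (eq_bigr (fun i => G i (n i))) => [|i /negPf ik].
  by rewrite mulrC [in RHS]mulrAC mulrCA mulfV // mulr1 mulrC.
by rewrite ffunE ik addn0.
Qed.

Lemma monom_incr t k n : monom t (incr k n) = t k * monom t n.
Proof.
rewrite /monom (bigD1 k) //= [in RHS](bigD1 k) //= ffunE eqxx addn1 exprS -mulrA.
by congr (_ * (_ * _)); apply: eq_bigr => i /negPf ik; rewrite ffunE ik addn0.
Qed.

Lemma multinom_incr k n :
  multinom (incr k n) = multinom n * (deg n).+1%:R / (n k).+1%:R.
Proof.
have f0 j : (j`!)%:R != 0 :> K by rewrite pnatr_eq0 -lt0n fact_gt0.
have p0 : \prod_i (n i)`!%:R != 0 :> K by apply/prodf_neq0.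
rewrite /multinom deg_incr (prod_incr (G := fun _ j => j`!%:R)) // !factS !natrM.
by field; rewrite nat1r p0 f0 pnatr_eq0.
Qed.

Lemma multinom_ge0 n : 0 <= multinom n.
Proof. by rewrite divr_ge0 ?ler0n // prodr_ge0 // => i _; rewrite ler0n. Qed.

(* The multinomial form of Pascal's rule. *)
Lemma multinom_rec t n : (0 < deg n)%N ->
  multinom n * monom t n
  = \sum_(k | (0 < n k)%N) t k * (multinom (decr k n) * monom t (decr k n)).
Proof.
move=> n0; have d0 : (deg n)%:R != 0 :> K by rewrite pnatr_eq0 -lt0n.
rewrite (eq_bigr (fun k => multinom n * monom t n / (deg n)%:R * (n k)%:R)).
  rewrite -mulr_sumr -natr_sum (_ : (\sum_(k | _) _)%N = deg n) ?divfK //.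
  rewrite /deg [RHS](bigID (fun i => 0 < n i)%N) /= [X in (_ = _ + X)%N]big1 ?addn0 //.
  by move=> i; rewrite -eqn0Ngt => /eqP.
move=> k /decrK; move: (decr k n) => d <-.
rewrite multinom_incr monom_incr deg_incr.
rewrite ffunE eqxx addn1.
by field; rewrite !nat1r !pnatr_eq0.
Qed.

Lemma sum_multinom_le t (S : {fset {ffun 'I_m -> nat}}) :
  (forall i, 0 <= t i) -> \sum_i t i < 1 ->
  \sum_(n <- S) multinom n * monom t n <= (1 - \sum_i t i)^-1.
Proof.
move=> t0 t1; pose w n := multinom n * monom t n.
have w0 n : 0 <= w n.
  by rewrite mulr_ge0 ?multinom_ge0 // prodr_ge0 // => i _; rewrite exprn_ge0.
(* The total degree over S bounds every entry of every n in S, so S lies in the box of side N. *)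
pose N := (\sum_(n <- S) deg n)%N.
pose h (f : {ffun 'I_m -> 'I_N.+1}) : {ffun 'I_m -> nat} := [ffun i => f i : nat].
pose B := [fset h f | f in {: {ffun 'I_m -> 'I_N.+1}}]%fset.
have inB n : (n \in B) = [forall i, n i <= N]%N.
  apply/imfsetP/forallP => [[f _ ->] i|nN]; first by rewrite /h ffunE -ltnS.
  by exists [ffun i => inord (n i)] => //; apply/ffunP => i; rewrite !ffunE inordK // ltnS nN.
have SB : (S `<=` B)%fset.
  apply/fsubsetP => n nS; rewrite inB; apply/forallP => i.
  rewrite /N (big_fsetD1 n) //= (leq_trans _ (leq_addr _ _)) //.
  by rewrite /deg (bigD1 i) //= leq_addr.
apply: (le_trans (ler_sum_fset w0 SB)).
set s := \sum_(n <- B) w n.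
(* This self-bound can be solved for s because sum_i t_i < 1. *)
suff : s <= 1 + (\sum_i t i) * s.
  by rewrite -lerBlDr -{1}[s]mul1r -mulrBl -ler_pdivlMl ?subr_gt0 // mulr1.
have zB : [ffun=> 0%N] \in B by rewrite inB; apply/forallP => i; rewrite ffunE.
rewrite {1}/s (big_fsetD1 _ zB) /= lerD //.
  rewrite /w /multinom /monom /deg !big1 ?divr1 ?mulr1 // => i _; rewrite ffunE //.
rewrite (@eq_fbigr _ _ _ _ _ _ _ (fun n => \sum_(k | (0 < n k)%N) t k * w (decr k n))) /=; last first.
  move=> n; rewrite !inE => /andP[n0 _] _; rewrite -multinom_rec //.
  rewrite lt0n; apply: contra n0; rewrite sum_nat_eq0 => /forallP n00.
  by apply/eqP/ffunP => i; rewrite ffunE; apply/eqP/(implyP (n00 i)).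
rewrite (exchange_big_dep predT) //= mulr_suml; apply: ler_sum => k _.
rewrite -mulr_sumr ler_wpM2l //.
rewrite big_fset_condE.
set T := [fset n | n in _ & _]%fset.
(* Lowering n_k is injective where n_k > 0 and keeps the box stable, so each inner sum is at most
   s. *)
have -> : \sum_(n <- T) w (decr k n) = \sum_(n <- [fset decr k n | n in T]%fset) w n.
  rewrite [RHS]big_imfset //= => x y; rewrite !inE => /andP[_ xk] /andP[_ yk] e.
  by rewrite -(decrK xk) e decrK.
apply: ler_sum_fset => //; apply/fsubsetP => _ /imfsetP[n /= + ->].
rewrite !inE => /andP[/andP[_ nB] _]; move: nB; rewrite !inB => /forallP nN.
by apply/forallP => i; rewrite ffunE (leq_trans _ (nN i)) // leq_subr.
Qed.

End Multinomial.

(** * Differentiation of power series *)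

Lemma ler_coord_norm (K : numFieldType) m (h : 'rV[K]_m) i : `|h 0 i| <= `|h|.
Proof.
rewrite -[leRHS]/(mx_norm h) mx_normE -[leLHS]nngE num_le.
exact: (le_bigmax _ _ (ord0, i)).
Qed.

Section QuadraticRemainder.
Context {K : numFieldType} {m : nat} {V : normedModType K}.

Definition lincomb (M : 'I_m -> V) (h : 'rV[K]_m) : V := \sum_i h 0 i *: M i.

Lemma lincomb_linear M : linear (lincomb M).
Proof.
move=> k h h'; rewrite /lincomb scaler_sumr -big_split; apply: eq_bigr => i _.
by rewrite !mxE scalerDl scalerA.
Qed.

HB.instance Definition _ M :=
  GRing.isLinear.Build K 'rV[K]_m V *:%R (lincomb M) (lincomb_linear M).

Lemma lincomb_continuous M : continuous (lincomb M).
Proof.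
apply: bounded_linear_continuous; apply/bounded_funP => r.
exists (r * \sum_i `|M i|) => h hr; rewrite mulr_sumr.
apply: le_trans (ler_norm_sum _ _ _) _; apply: ler_sum => i _.
by rewrite normrZ ler_wpM2r // (le_trans (ler_coord_norm _ _)).
Qed.

(** A quadratic remainder is little-o of h, and uniqueness of the differential identifies it with
    [lincomb M]. *)
Lemma differentiable_quadratic (f : 'rV[K]_m -> V) x M r C : 0 < r -> 0 <= C ->
  (forall h, `|h| <= r -> `|f (x + h) - f x - lincomb M h| <= C * `|h| ^+ 2) ->
  differentiable f x /\ forall h, 'd f x h = lincomb M h.
Proof.
move=> r0 C0 fC.
suff small : f \o shift x = cst (f x) + lincomb M +o_ (0 : 'rV[K]_m) id.
  have dE := @diff_unique K _ V f (lincomb M) x (@lincomb_continuous M) small.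
  split; last by move=> h; rewrite dE.
  by apply/diff_locallyP; rewrite dE; split=> //; exact: lincomb_continuous.
(* C may be 0; C + 1 is a positive divisor for the condition |h| <= e / (C + 1). *)
have C1 : 0 < C + 1 by rewrite ltr_wpDl.
apply/eqaddoP => e e0; near=> h.
have -> : (f \o shift x - (cst (f x) + lincomb M)) h
        = f (x + h) - f x - lincomb M h.
  by rewrite !fctE /= opprD addrA [h + x]addrC.
apply: (le_trans (fC h _)); first by near: h; exact: (@nbhs0_le K 'rV[K]_m).
rewrite expr2 mulrA ler_wpM2r //.
apply: (@le_trans _ _ ((C + 1) * `|h|)); first by rewrite ler_wpM2r // lerDl.
rewrite mulrC -ler_pdivlMr //; near: h; apply: (@nbhs0_le K 'rV[K]_m); exact: divr_gt0.
Unshelve. all: by end_near. Qed.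

End QuadraticRemainder.

(** * Uniform first order Taylor bounds for monomials *)

Section Jets.
Context {K : numFieldType}.

(* First order Taylor expansion of a quantity p(s) with value p0 and logarithmic
   derivative l at s = 0, with both remainders controlled by the increment
   M - m0 of a majorant; this shape of bound is stable under products. *)
Definition jet (s p0 l p m0 M : K) :=
  [/\ `|p0| <= m0, m0 <= M, `|p - p0| <= s * (M - m0)
    & `|p - p0 - p0 * l| <= s ^+ 2 * (M - m0)].

Lemma jet_one s : jet s 1 0 1 1 1.
Proof. by split; rewrite ?normr1 ?subrr ?mulr0 ?subr0 ?normr0. Qed.

(** The remainders of pq and the increment MN - m0 n0 expand into the same three terms. In the first
    order bound, s <= 1 absorbs the extra s from the product of two increments. *)
Lemma jet_mul s p0 l p m0 M q0 k q n0 N : 0 <= s -> s <= 1 ->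
  jet s p0 l p m0 M -> jet s q0 k q n0 N ->
  jet s (p0 * q0) (l + k) (p * q) (m0 * n0) (M * N).
Proof.
move=> s0 s1 [hp mM dp ddp] [hq nN dq ddq].
have m00 : 0 <= m0 by exact: le_trans hp.
have n00 : 0 <= n0 by exact: le_trans hq.
have mM0 : 0 <= M - m0 by rewrite subr_ge0.
have nN0 : 0 <= N - n0 by rewrite subr_ge0.
split; first by rewrite normrM ler_pM.
- by rewrite ler_pM.
- have -> : p * q - p0 * q0 = (p - p0) * q0 + p0 * (q - q0) + (p - p0) * (q - q0).
    by ring.
  have -> : s * (M * N - m0 * n0) = s * (M - m0) * n0 + m0 * (s * (N - n0))
                              + s * (M - m0) * (N - n0) by ring.
  do 2?(apply: le_trans (ler_normD _ _) _; apply: lerD); rewrite normrM ler_pM //.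
  by apply: le_trans dq _; rewrite ler_piMl.
- have -> : p * q - p0 * q0 - p0 * q0 * (l + k)
      = (p - p0 - p0 * l) * q0 + p0 * (q - q0 - q0 * k) + (p - p0) * (q - q0).
    by ring.
  have -> : s ^+ 2 * (M * N - m0 * n0) = s ^+ 2 * (M - m0) * n0
      + m0 * (s ^+ 2 * (N - n0)) + s * (M - m0) * (s * (N - n0)) by ring.
  by do 2?(apply: le_trans (ler_normD _ _) _; apply: lerD); rewrite normrM ler_pM.
Qed.

Lemma jet_exp s p0 l p m0 M n : 0 <= s -> s <= 1 ->
  jet s p0 l p m0 M -> jet s (p0 ^+ n) (l *+ n) (p ^+ n) (m0 ^+ n) (M ^+ n).
Proof.
move=> s0 s1 h; elim: n => [|n IH]; first exact: jet_one.
by rewrite !exprS mulrS; exact: jet_mul.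
Qed.

Lemma jet_prod (I : Type) (r : seq I) s p0 l p m0 M : 0 <= s -> s <= 1 ->
  (forall i, jet s (p0 i) (l i) (p i) (m0 i) (M i)) ->
  jet s (\prod_(i <- r) p0 i) (\sum_(i <- r) l i) (\prod_(i <- r) p i)
    (\prod_(i <- r) m0 i) (\prod_(i <- r) M i).
Proof.
move=> s0 s1 h; elim: r => [|i r IH]; first by rewrite !big_nil; exact: jet_one.
by rewrite !big_cons; exact: jet_mul.
Qed.

Lemma jet_translate s x h r : x != 0 -> 0 <= s -> 0 <= r -> `|h| <= s * r ->
  jet s x (h / x) (x + h) `|x| (`|x| + r).
Proof.
move=> x0 s0 r0 hr; split=> //; first by rewrite lerDl.
  by rewrite addrC addKr addrC addKr.
rewrite mulrCA mulfV // mulr1 [x + h]addrC addrK subrr normr0.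
by rewrite addrC addKr mulr_ge0 // exprn_ge0.
Qed.

(** With r fixed and s = |h| / r, the remainder is quadratic in h, and its majorant is a monomial at
    the enlarged radii |x_i| + r. *)
Lemma monom_jet m (x h : 'I_m -> K) s r (n : {ffun 'I_m -> nat}) :
  0 <= s -> s <= 1 -> 0 <= r ->
  (forall i, x i != 0) -> (forall i, `|h i| <= s * r) ->
  `|monom (fun i => x i + h i) n - monom x n
    - monom x n * \sum_i (n i)%:R * (h i / x i)|
  <= s ^+ 2 * monom (fun i => `|x i| + r) n.
Proof.
move=> s0 s1 r0 x0 hr.
have J i : jet s (x i ^+ n i) ((n i)%:R * (h i / x i)) ((x i + h i) ^+ n i)
             (`|x i| ^+ n i) ((`|x i| + r) ^+ n i).
  by rewrite mulr_natl; apply/jet_exp/jet_translate.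
have [_ _ _] := jet_prod (index_enum _) s0 s1 J.
move/le_trans; apply; rewrite ler_wpM2l ?exprn_ge0 // gerBl prodr_ge0 //.
Qed.

End Jets.

(** * Coefficient families of almost multinomial growth *)

Section Tame.
Context {K : numClosedFieldType} {m : nat}.
Implicit Types A B : {ffun 'I_m -> nat} -> K.

(** Allowing every mu > 1 makes the class stable under factors polynomial in n, hence under termwise
    application of theta_k. *)
Definition tame A := forall mu : K, 1 < mu ->
  exists2 C, 0 <= C & forall n, `|A n| <= C * mu ^+ deg n * multinom n.

Lemma tameZ z A : tame A -> tame (fun n => z * A n).
Proof.
move=> tA mu /tA[C C0 hC]; exists (`|z| * C); first by rewrite mulr_ge0.
by move=> n; rewrite normrM -!mulrA ler_wpM2l // mulrA.
Qed.

Lemma tameD A B : tame A -> tame B -> tame (fun n => A n + B n).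
Proof.
move=> tA tB mu mu1; have [C C0 hC] := tA _ mu1; have [D D0 hD] := tB _ mu1.
exists (C + D); first by rewrite addr_ge0.
by move=> n; rewrite !mulrDl (le_trans (ler_normD _ _)) // lerD.
Qed.

Lemma bernoulli_le (mu : K) n : 1 < mu -> n%:R * (mu - 1) <= mu ^+ n.
Proof.
move=> mu1; suff : 1 + n%:R * (mu - 1) <= mu ^+ n.
  by apply: le_trans; rewrite lerDr.
have mu10 : 0 <= mu - 1 by rewrite subr_ge0 ltW.
elim: n => [|n IH]; first by rewrite mul0r addr0.
have -> : mu ^+ n.+1 = mu ^+ n + mu ^+ n * (mu - 1) by rewrite exprSr; ring.
rewrite -natr1 mulrDl mul1r addrA lerD // ler_peMl //.
by rewrite exprn_ege1 // ltW.
Qed.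

Lemma sqrtC_gt1 (mu : K) : 1 < mu -> 1 < sqrtC mu.
Proof.
by move=> mu1; rewrite -sqrtC1 ltr_sqrtC ?qualifE /= ?ler01 // ltW // (lt_trans _ mu1).
Qed.

(** With mu = nu^2, one factor nu^|n| bounds A and the other absorbs n_k through n_k <= nu^|n| / (nu
    - 1). *)
Lemma tame_idx k A : tame A -> tame (fun n => (n k)%:R * A n).
Proof.
move=> tA mu mu1; have nu1 := sqrtC_gt1 mu1.
set nu := sqrtC mu in nu1; have nu0 : 0 < nu - 1 by rewrite subr_gt0.
have nup : 0 < nu by exact: lt_trans nu1.
have [C C0 hC] := tA _ nu1; exists (C / (nu - 1)) => [|n].
  by rewrite divr_ge0 // ltW.
rewrite normrM normr_nat.
have -> : C / (nu - 1) * mu ^+ deg n * multinom n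
        = (nu ^+ deg n / (nu - 1)) * (C * nu ^+ deg n * multinom n).
  by rewrite -(sqrtCK mu) -/nu -exprM mulnC exprM expr2; ring.
rewrite ler_pM // ler_pdivlMr //; apply: le_trans (bernoulli_le (deg n) nu1).
by rewrite ler_wpM2r ?(ltW nu0) // ler_nat /deg (bigD1 k) //= leq_addr.
Qed.

Lemma tame_bound A (r : 'I_m -> K) : tame A -> (forall i, 0 <= r i) ->
  \sum_i r i < 1 -> exists M, forall S : {fset {ffun 'I_m -> nat}},
    \sum_(n <- S) `|A n| * monom r n <= M.
Proof.
move=> tA r0; set t := \sum_i r i => t1.
have t0 : 0 <= t by rewrite sumr_ge0.
have t10 : 0 < 1 + t by rewrite ltr_pwDl.
(* This mu exceeds 1, yet mu t < 1 since 2 t < 1 + t. *)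
pose mu : K := 2 / (1 + t).
have mu1 : 1 < mu by rewrite ltr_pdivlMr // mul1r -[2]/(1 + 1) ltrD2l.
have [C C0 hC] := tA _ mu1.
have mur : \sum_i mu * r i < 1.
  rewrite -mulr_sumr -/t mulrAC ltr_pdivrMr // mul1r.
  by rewrite mulr_natl mulr2n ltrD2r.
have mur0 i : 0 <= mu * r i by rewrite mulr_ge0 // (le_trans ler01) // ltW.
exists (C * (1 - \sum_i mu * r i)^-1) => S.
apply: le_trans (_ : \sum_(n <- S) C * (multinom n * monom (fun i => mu * r i) n) <= _).
  apply: ler_sum => n _; apply: le_trans (_ : C * mu ^+ deg n * multinom n * monom r n <= _).
    by rewrite ler_wpM2r // prodr_ge0 // => i _; rewrite exprn_ge0.
  have -> : monom (fun i => mu * r i) n = mu ^+ deg n * monom r n.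
    rewrite /monom /deg -prodrXr -big_split; apply: eq_bigr => i _ /=.
    by rewrite exprMn.
  by rewrite le_eqVlt; apply/orP; left; apply/eqP; ring.
by rewrite -mulr_sumr ler_wpM2l // sum_multinom_le.
Qed.

End Tame.

Section LauricellaCoefficients.
Context {K : numClosedFieldType} {m : nat}.
Hypothesis archi : forall x : K, exists n : nat, `|x| < n%:R.
Variables (a : K) (b c : 'I_m -> K).

Definition lauricella (n : {ffun 'I_m -> nat}) : K :=
  poch a (deg n) * \prod_i poch (b i) (n i)
  / (\prod_i poch (c i) (n i) * \prod_i poch 1 (n i)).

(** Compare (a,|n|) with |n|! and each (b_i,n_i) with (c_i,n_i), each at the cost of a power of nu;
    the exponents add up to 2|n|, and nu^2 = mu. *)
Lemma tame_lauricella : (forall i (n : nat), c i != - n%:R) -> tame lauricella.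
Proof.
move=> hc mu mu1; have nu1 := sqrtC_gt1 mu1.
set nu := sqrtC mu in nu1; have nu0 : 0 < nu by exact: lt_trans nu1.
have [|C0 C00 hC0] := @poch_growth K archi a 1 nu _ nu1.
  by move=> n; rewrite -addr_eq0 nat1r pnatr_eq0.
have /choice[C hC] i : exists C, 0 <= C /\
    forall n, `|poch (b i) n| <= C * nu ^+ n * `|poch (c i) n|.
  by have [D D0 hD] := poch_growth archi (b i) (hc i) nu1; exists D.
exists (C0 * \prod_i C i) => [|n].
  by rewrite mulr_ge0 // prodr_ge0 // => i _; case: (hC i).
have -> : C0 * (\prod_i C i) * mu ^+ deg n * multinom n
    = (C0 * nu ^+ deg n * (deg n)`!%:R)
      * \prod_i (C i * nu ^+ n i) * (\prod_i (n i)`!%:R)^-1.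
  rewrite big_split /= prodrXr -/(deg n) /multinom -(sqrtCK mu) -/nu.
  by rewrite -exprM mulnC exprM expr2; ring.
rewrite /lauricella invfM !normrM !normfV [X in _ * `|X|^-1](eq_bigr _
  (fun i _ => poch1 K (n i))) [X in _ / X](_ : _ = \prod_i (n i)`!%:R); last first.
  by rewrite normr_prod; apply: eq_bigr => i _; rewrite normr_nat.
rewrite mulrA ler_wpM2r ?invr_ge0 //.
  by rewrite prodr_ge0 // => i _; rewrite ler0n.
rewrite -mulrA ler_pM //.
  by have := hC0 (deg n); rewrite poch1 normr_nat.
rewrite !normr_prod -prodfV -big_split /=; apply: ler_prod => i _.
have pc : 0 < `|poch (c i) (n i)|.
  by rewrite normr_gt0; apply/prodf_neq0 => j _; rewrite addr_eq0.
by rewrite divr_ge0 //= ler_pdivrMr //; case: (hC i).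
Qed.

End LauricellaCoefficients.

(** * Power series on D and their termwise differentiation *)

Section PowerSeries.
Context {R : realType} {m : nat}.
Local Notation K := (CC R).
Implicit Types (A : {ffun 'I_m -> nat} -> K) (x : 'rV[K]_m).

Definition power_series A x : K :=
  summability.sum (fun n => A n * monom (fun i => x 0 i) n).

Lemma has_sum_power_series A x : tame A -> DD x ->
  has_sum (fun n => A n * monom (fun i => x 0 i) n) (power_series A x).
Proof.
move=> tA xD; have [//|B hB] := @tame_bound _ _ A (fun i => `|x 0 i|) tA _ xD.
have [|l hl] := @has_sum_complex R _ (fun n => A n * monom (fun i => x 0 i) n) B.
  move=> S; apply: le_trans (hB S); apply: ler_sum => n _.
  rewrite normrM /monom normr_prod ler_wpM2l //; apply: ler_prod => i _.
  by rewrite normr_ge0 normrX /=.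
by rewrite /power_series (has_sumP hl).
Qed.

Lemma power_seriesZ z A x : tame A -> DD x ->
  power_series (fun n => z * A n) x = z * power_series A x.
Proof.
move=> tA xD; apply: has_sum_unique (has_sum_power_series (tameZ z tA) xD) _.
under [fun n => _]funext do rewrite -mulrA.
exact/has_sumZ/has_sum_power_series.
Qed.

Lemma power_seriesD A B x : tame A -> tame B -> DD x ->
  power_series (fun n => A n + B n) x = power_series A x + power_series B x.
Proof.
move=> tA tB xD; apply: has_sum_unique (has_sum_power_series (tameD tA tB) xD) _.
under [fun n => _]funext do rewrite mulrDl.
by apply: has_sumD; exact: has_sum_power_series.
Qed.

Definition theta_coef k A : {ffun 'I_m -> nat} -> K := fun n => (n k)%:R * A n.

Lemma power_series_quadratic A x : tame A -> DD x -> (forall i, x 0 i != 0) ->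
  exists r C, [/\ 0 < r, 0 <= C & forall h, `|h| <= r -> DD (x + h) /\
    `|power_series A (x + h) - power_series A x
      - lincomb (fun k => power_series (theta_coef k A) x / x 0 k : K) h|
    <= C * `|h| ^+ 2].
Proof.
move=> tA xD x0; set t : K := \sum_i `|x 0 i|.
have t1 : 0 < 1 - t by rewrite subr_gt0.
(* Dividing by m + 1 leaves strict room: the m radii grow by m r < 1 - t in total. *)
pose r : K := (1 - t) / m.+1%:R; have r0 : 0 < r by rewrite divr_gt0 // ltr0n.
have tr : \sum_i (`|x 0 i| + r) < 1.
  rewrite big_split sumr_const card_ord /= -ltrBrDl -/t /r -mulrnAl -mulr_natr.
  by rewrite ltr_pdivrMr ?ltr0n // ltr_pM2l // ltr_nat.
have [|B hB] := tame_bound tA _ tr; first by move=> i; rewrite addr_ge0 // ltW.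
have B0 : 0 <= B by have := hB fset0; rewrite big_seq_fset0.
exists r, (B / r ^+ 2); split=> // [|h hr].
  by rewrite divr_ge0 // exprn_ge0 // ltW.
have hi i : `|h 0 i| <= r by apply: le_trans (ler_coord_norm _ _) hr.
have xhD : DD (x + h).
  rewrite /DD /=; apply: le_lt_trans tr; apply: ler_sum => i _.
  by rewrite mxE (le_trans (ler_normD _ _)) // lerD2l.
split=> //; pose s := `|h| / r; have s0 : 0 <= s by rewrite divr_ge0 // ltW.
have s1 : s <= 1 by rewrite ler_pdivrMr // mul1r.
have hs i : `|h 0 i| <= s * r by rewrite divfK ?gt_eqF // ler_coord_norm.
have -> : B / r ^+ 2 * `|h| ^+ 2 = s ^+ 2 * B.
  by rewrite [s ^+ 2]expr_div_n mulrAC -mulrA mulrC.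
(* The Taylor remainder of the n-th term; its sum is the remainder of the series, estimated term by
   term with [monom_jet]. *)
pose f n := A n * monom (fun i => (x + h) 0 i) n + -1 * (A n * monom (fun i => x 0 i) n)
  + -1 * \sum_k h 0 k / x 0 k * (theta_coef k A n * monom (fun i => x 0 i) n).
have : has_sum f (power_series A (x + h) + -1 * power_series A x
   + -1 * \sum_k h 0 k / x 0 k * power_series (theta_coef k A) x).
  apply: has_sumD; first by apply/has_sumD/has_sumZ; exact: has_sum_power_series.
  apply/has_sumZ/has_sum_big => k _; apply/has_sumZ/has_sum_power_series => //.
  exact: tame_idx.
rewrite !mulN1r (_ : \sum_k _ = lincomb (fun k => power_series (theta_coef k A) x / x 0 k : K) h).
  move/has_sum_le; apply => S; apply: le_trans (ler_norm_sum _ _ _) _.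
  apply: le_trans (_ : \sum_(n <- S) s ^+ 2 * (`|A n| * monom (fun i => `|x 0 i| + r) n) <= _).
    apply: ler_sum => n _.
    have -> : f n = A n * (monom (fun i => x 0 i + h 0 i) n - monom (fun i => x 0 i) n
        - monom (fun i => x 0 i) n * \sum_i (n i)%:R * (h 0 i / x 0 i)).
      rewrite /f !mulN1r !mulrBr; congr (_ - _ - _).
        by congr (_ * _); apply: eq_bigr => i _; rewrite mxE.
      rewrite !mulr_sumr; apply: eq_bigr => i _; rewrite /theta_coef; ring.
    rewrite normrM mulrCA ler_wpM2l //; apply: monom_jet => //; exact: ltW.
  by rewrite -mulr_sumr ler_wpM2l // exprn_ge0.
apply: eq_bigr => k _; rewrite -mulrA [_^-1 * _]mulrC; by [].
Qed.

Definition in_torus_domain x := DD x /\ forall i, x 0 i != 0.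

(** The order on [CC R] is partial, but positive elements are real and so comparable. *)
Lemma exists_radius (r s : K) : 0 < r -> 0 < s -> exists t, [/\ 0 < t, t <= r & t <= s].
Proof.
move=> r0 s0; have [rs|sr] := real_leP (gtr0_real r0) (gtr0_real s0).
  by exists r.
by exists s; split=> //; exact: ltW.
Qed.

Lemma torus_nbhd x : in_torus_domain x ->
  exists2 r : K, 0 < r & forall h, `|h| <= r -> forall i, (x + h) 0 i != 0.
Proof.
move=> [_ x0]; pose s : K := 1 + \sum_i `|x 0 i|^-1.
have xi0 i : 0 < `|x 0 i| by rewrite normr_gt0.
have s0 : 0 < s by rewrite ltr_pwDl // sumr_ge0 // => i _; rewrite invr_ge0.
exists s^-1 => [|h hs i]; first by rewrite invr_gt0.
rewrite mxE addr_eq0; apply/eqP => e.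
have : `|x 0 i| <= s^-1.
  by rewrite e normrN; apply: le_trans (ler_coord_norm _ _) hs.
rewrite -[leRHS]mul1r ler_pdivlMr // mulrC -ler_pdivlMr // mul1r => /le_gtF/negP.
by apply; rewrite /s (bigD1 i) //= addrCA ltrDl ltr_pwDl ?ltr01 // sumr_ge0.
Qed.

(** Agreement of f with the series is asked only on the open set where no x_i vanishes. This lets
    theta be iterated, as theta f is identified with a series only there. *)
Lemma differentiable_power_series f A x : tame A -> in_torus_domain x ->
  (forall y, in_torus_domain y -> f y = power_series A y) ->
  differentiable f x /\ forall h : 'rV[K]_m,
    'd f x h = \sum_k h 0 k / x 0 k * power_series (theta_coef k A) x.
Proof.
move=> tA xT fE; have [xD x0] := xT.
have [r [C [r0 C0 hC]]] := power_series_quadratic tA xD x0.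
have [s s0 hs] := torus_nbhd xT.
have [u [u0 ur us]] := exists_radius r0 s0.
have [h hu|df dE] := @differentiable_quadratic K m K f x
  (fun k => power_series (theta_coef k A) x / x 0 k) u C u0 C0.
  have [xhD le] := hC _ (le_trans hu ur).
  by rewrite !fE //; split=> //; exact/hs/(le_trans hu us).
split=> // h; rewrite dE; apply: eq_bigr => k _.
by rewrite -mulrA [_^-1 * _]mulrC.
Qed.

Lemma theta_power_series i f A x : tame A -> in_torus_domain x ->
  (forall y, in_torus_domain y -> f y = power_series A y) ->
  theta i f x = power_series (theta_coef i A) x.
Proof.
move=> tA xT fE; have [df dE] := differentiable_power_series tA xT fE.
rewrite /theta deriveE // dE (bigD1 i) //= big1 => [|k ki].
  by rewrite mxE !eqxx addr0 mul1r mulrA mulfV ?mul1r //; case: xT.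
by rewrite mxE (negPf ki) andbF !mul0r.
Qed.

Lemma tame_prod_affine (u v : 'I_m -> K) A : tame A ->
  tame (fun n => \prod_i (u i * (n i)%:R + v i) * A n).
Proof.
move=> tA; elim: (index_enum _) => [|i r IH].
  by under [X in tame X]funext do rewrite big_nil mul1r.
under [X in tame X]funext do rewrite big_cons -mulrA mulrDl -mulrA.
by apply: tameD; [exact/tameZ/tame_idx|exact: tameZ].
Qed.

Lemma power_series_sum (J : Type) (r : seq J) (z : J -> K) B x :
  (forall j, tame (B j)) -> DD x ->
  tame (fun n => \sum_(j <- r) z j * B j n) /\
  power_series (fun n => \sum_(j <- r) z j * B j n) x = \sum_(j <- r) z j * power_series (B j) x.
Proof.
move=> tB xD; elim: r => [|j r [tr IH]].
  have t0 : tame (fun _ : {ffun 'I_m -> nat} => 0 : K).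
    move=> mu _; exists 0 => // n; by rewrite normr0 !mul0r.
  under [fun n => \sum_(_ <- _) _]funext do rewrite big_nil.
  rewrite big_nil; split=> //.
  have -> : (fun _ => 0) = (fun n => 0 * (fun _ => 0) n) :> ({ffun 'I_m -> nat} -> K).
    by apply/funext => n; rewrite mul0r.
  by rewrite power_seriesZ // mul0r.
under [fun n => \sum_(_ <- _) _]funext do rewrite big_cons.
have tj := tameZ (z j) (tB j).
by rewrite big_cons; split; [exact: tameD|rewrite power_seriesD // IH power_seriesZ].
Qed.

(** Multiplication by x_k shifts the exponents by e_k; coefficients with n_k = 0 are outside the
    image of the shift and are set to 0. *)
Lemma power_series_shift (k : 'I_m) A x : tame A -> DD x ->
  has_sum (fun n : {ffun 'I_m -> nat} => (if (0 < n k)%N then A (decr k n) else 0)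
                    * monom (fun i => x 0 i) n) (x 0 k * power_series A x).
Proof.
move=> tA xD; apply: (has_sum_reindex (@incrK m k)).
  move=> n; case: ifP => [/decrK //|_]; by rewrite mul0r eqxx.
under [_ \o _]funext => n.
  rewrite /= ffunE eqxx addn1 /= incrK monom_incr mulrCA; over.
exact/has_sumZ/has_sum_power_series.
Qed.

End PowerSeries.

(** * Lauricella's system *)

(** Writes G as a sum of scalar functions times standard columns and differentiates summand by
    summand. *)
Lemma differentiable_col (K : numFieldType) m p (f : 'I_p -> 'rV[K]_m -> K)
    (G : 'rV[K]_m -> 'cV[K]_p) x :
  (forall y, G y = \col_k f k y) -> (forall k, differentiable (f k) x) ->
  differentiable G x /\ forall h, 'd G x h = \col_k 'd (f k) x h.
Proof.
move=> GE df; pose F k (y : 'rV[K]_m) : 'cV[K]_p := f k y *: delta_mx k 0.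
have -> : G = \sum_(k <- index_enum _) F k.
  apply/funext => y; rewrite GE fct_sumE; apply/colP => k.
  rewrite summxE (bigD1 k) //= !mxE !eqxx mulr1 big1 ?addr0 // => j jk.
  by rewrite !mxE eq_sym (negPf jk) mulr0.
have dF k : differentiable (F k) x by exact: differentiableZl.
have [dG dGE] : differentiable (\sum_(k <- index_enum _) F k) x /\
    forall h, 'd (\sum_(k <- index_enum _) F k) x h
      = \sum_(k <- index_enum _) 'd (F k) x h.
  elim: (index_enum _) => [|k r [dr IH]].
    rewrite big_nil (_ : 0 = cst (0 : 'cV[K]_p)) //.
    split=> [|h]; first exact: differentiable_cst.
    by rewrite big_nil (diff_cst _ (x : 'rV[K]_m)).
  rewrite big_cons; split; first exact: differentiableD.
  move=> h; rewrite big_cons -IH.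
  exact: (congr1 (fun D => D h) (diffD (dF k) dr)).
have dFE k h : 'd (F k) x h = 'd (f k) x h *: delta_mx k 0.
  by rewrite [X in X h](diffZl _ (df k)).
split=> // h; rewrite dGE; apply/colP => k; rewrite mxE summxE.
rewrite (bigD1 k) //= big1 => [|j jk]; rewrite dFE !mxE.
  by rewrite !eqxx mulr1 addr0.
by rewrite eq_sym (negPf jk) mulr0.
Qed.

Lemma diff_affine (K : numFieldType) m (f : 'rV[K]_m -> K) (u : 'I_m -> K) x h :
  (forall h, f (x + h) - f x = \sum_i h 0 i * u i) ->
  'd f x h = \sum_i h 0 i * u i.
Proof.
move=> fE.
have [//|_ ->//] := @differentiable_quadratic K m K f x u 1 0 ltr01 (lexx 0).
by move=> k _; rewrite fE subrr normr0 mul0r.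
Qed.

Lemma dlog_coord_fun (K : numClosedFieldType) m (k : 'I_m) (x h : 'rV[K]_m) :
  dlog (coord_fun k) x h = h 0 k / x 0 k.
Proof.
rewrite /dlog; congr (_ / _).
have sumE (y : 'rV[K]_m) : \sum_i y 0 i * (i == k)%:R = y 0 k.
  rewrite (bigD1 k) //= eqxx mulr1 big1 ?addr0 // => i /negPf ->.
  by rewrite mulr0.
rewrite (@diff_affine _ _ _ (fun i => (i == k)%:R)) ?sumE // => y.
by rewrite /coord_fun mxE addrAC subrr add0r sumE.
Qed.

Lemma dlog_one_minus (K : numClosedFieldType) m (v : Z2 m) (x h : 'rV[K]_m) :
  dlog (one_minus v) x h = - (\sum_i (v i)%:R * h 0 i) / one_minus v x.
Proof.
rewrite /dlog; congr (_ / _).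
rewrite (@diff_affine _ _ _ (fun i => - (v i)%:R)) => [|y].
  by rewrite -sumrN; apply: eq_bigr => i _; rewrite mulrN mulrC.
rewrite /one_minus opprD opprK addrACA subrr add0r -sumrN -big_split /=.
by apply: eq_bigr => i _; rewrite mxE; ring.
Qed.

(** * The functions g_w and the closed system they satisfy *)

Section LauricellaSystem.
Context {R : realType} {m : nat}.
Local Notation K := (CC R).
Variables (a : K) (b c : 'I_m -> K) (kappa : K).
Hypothesis hc : forall i (n : nat), c i != - n%:R.
Hypothesis beta0 : forall e i, beta b c e i != 0.

Notation beta := (beta b c).

Let scaled n : K := kappa * lauricella a b c n.

Let tame_scaled : tame scaled.
Proof. by apply/tameZ/tame_lauricella => //; exact: CC_archimedean. Qed.

(** The eigenvalue on x_i^n of -(theta_i + b_i) / beta_(1,i), or of the identity, in the affine form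
    required by [tame_prod_affine]. *)
Let factor (e : bool) i (n : nat) : K :=
  (if e then - (beta true i)^-1 else 0) * n%:R
  + (if e then - (b i / beta true i) else 1).

Definition shifted_coef (w : Z2 m) (n : {ffun 'I_m -> nat}) : K :=
  \prod_i factor (w i) i (n i) * scaled n.

Definition theta_prod_coef (v : Z2 m) (n : {ffun 'I_m -> nat}) : K :=
  \prod_i ((v i)%:R * (n i)%:R + (~~ v i)%:R) * scaled n.

Lemma tame_shifted w : tame (shifted_coef w).
Proof. exact: tame_prod_affine. Qed.

(** F = P g on coefficients. In one coordinate with v_i = 1 it reads n = -beta_0 + (-beta_1) (-(n +
    b) / beta_1), with beta_0 = b. *)
Lemma theta_prod_coefE (v : Z2 m) (n : {ffun 'I_m -> nat}) :
  theta_prod_coef v n = \sum_w p_coef b c v w * shifted_coef w n.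
Proof.
rewrite /theta_prod_coef /shifted_coef.
under [RHS]eq_bigr do rewrite mulrA p_coefE.
rewrite -mulr_suml (sum_prod_factor (fun e i => t_factor b c (v i) e i)
  (fun e i => factor e i (n i))).
congr (_ * _); apply: eq_bigr => i _; rewrite /factor /t_factor.
have := beta0 true i; rewrite -[b i]/(beta false i).
by case: (v i) => /=; move: (beta true i) (beta false i) => x y h; field.
Qed.

(** The two-term recurrence of the coefficients in direction k, with denominators cleared. *)
Let lauricella_incr (k : 'I_m) (n : {ffun 'I_m -> nat}) :
  scaled (incr k n) * (c k + (n k)%:R) * (n k).+1%:R
  = scaled n * (a + (deg n)%:R) * (b k + (n k)%:R).
Proof.
have pc i j : poch (c i) j != 0.
  by apply/prodf_neq0 => l _; rewrite addr_eq0.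
have p1 j : poch 1 j != 0 :> K by rewrite poch1 pnatr_eq0 -lt0n fact_gt0.
have prodE (l : 'I_m -> K) : \prod_i poch (l i) (incr k n i)
    = \prod_i poch (l i) (n i) * (l k + (n k)%:R).
  rewrite (bigD1 k) //= [in RHS](bigD1 k) //= ffunE eqxx addn1 pochS.
  rewrite mulrAC; congr (_ * _ * _); apply: eq_bigr => i /negPf ik.
  by rewrite ffunE ik addn0.
rewrite /scaled /lauricella deg_incr !pochS !prodE -nat1r.
have := pc k; have ck := hc k (n k); rewrite -addr_eq0 in ck.
have nk : 1 + (n k)%:R != 0 :> K by rewrite nat1r pnatr_eq0.
have h1 : \prod_i poch (c i) (n i) != 0 by apply/prodf_neq0.
have h2 : \prod_i poch 1 (n i) != 0 :> K by apply/prodf_neq0.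
by move=> _; field; rewrite h1 h2 nk ck.
Qed.

Let shifted_split (k : 'I_m) (w : Z2 m) (n : {ffun 'I_m -> nat}) : shifted_coef w n
  = factor (w k) k (n k) * (\prod_(i | i != k) factor (w i) i (n i) * scaled n).
Proof. by rewrite /shifted_coef (bigD1 k) //= mulrA. Qed.

Let shifted_flip (k : 'I_m) (w : Z2 m) (n : {ffun 'I_m -> nat}) : shifted_coef (flip k w) n
  = factor (~~ w k) k (n k) * (\prod_(i | i != k) factor (w i) i (n i) * scaled n).
Proof.
rewrite (shifted_split k) flip_id; congr (_ * (_ * _)).
by apply: eq_bigr => i ik; rewrite flip_ne.
Qed.

(* Lauricella's differential equation in the k-th variable, on coefficients. *)
Lemma theta_shifted_coef (k : 'I_m) (v : Z2 m) (n : {ffun 'I_m -> nat}) :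
  (n k)%:R * shifted_coef v n
  = edge b c (fun w => shifted_coef w n) k v
    + (v k)%:R * (if (0 < n k)%N then
        (a + (deg (decr k n))%:R) * shifted_coef v (decr k n) else 0).
Proof.
rewrite /edge shifted_flip (shifted_split k v n) /factor.
have b1 := beta0 true k.
set X := \prod_(i | _) _ * _.
have bE : beta false k = b k by [].
case vk: (v k); rewrite ?mul0r ?addr0 /= ?bE; last by field.
(* At n_k = 0 the edge term vanishes; otherwise the recurrence is used at n' = n - e_k. *)
case: posnP => [->|nk]; first by field.
pose n' := decr k n; have nE : n = incr k n' by rewrite decrK.
rewrite -/n' (shifted_split k v n') vk /factor.
have XE : X = \prod_(i | i != k) factor (v i) i (n' i) * scaled n.
  by rewrite /X; congr (_ * _); apply: eq_bigr => i /negPf ik; rewrite nE ffunE ik addn0.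
have nkE : (n k)%:R = 1 + (n' k)%:R :> K by rewrite nE ffunE eqxx addn1 nat1r.
have := lauricella_incr k n'; rewrite -nE XE nkE -nat1r.
have -> : c k = beta true k + 1 + b k by rewrite /Defs.beta; ring.
move: (\prod_(i | _) _) (scaled n) (scaled n') (n' k)%:R (deg n')%:R => Y s s' j d.
move: (beta true k) b1 => B B0 e.
have -> : (a + d) * ((- B^-1 * j + - (b k / B)) * (Y * s'))
        = - Y / B * (s' * (a + d) * (b k + j)) by field.
by rewrite -e; field.
Qed.

Let sh w x : K := power_series (shifted_coef w) x.
Let th k w x : K := power_series (theta_coef k (shifted_coef w)) x.
(** The function (theta + a) g_v, where theta is the Euler operator. *)
Let T v x : K := a * sh v x + \sum_j th j v x.

Let tame_theta k w : tame (theta_coef k (shifted_coef w)).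
Proof. exact/tame_idx/tame_shifted. Qed.

Lemma theta_shifted k v x : DD x ->
  th k v x = edge b c (fun w => sh w x) k v + (v k)%:R * (x 0 k * T v x).
Proof.
move=> xD; have Ls w := has_sum_power_series (tame_shifted w) xD.
pose B (n : {ffun 'I_m -> nat}) := a * shifted_coef v n
  + \sum_(j < m) 1 * theta_coef j (shifted_coef v) n.
have [tS sS] := power_series_sum (index_enum _) (fun=> 1) (fun j => tame_theta j v) xD.
have tB : tame B by apply: tameD tS; exact/tameZ/tame_shifted.
have BT : power_series B x = T v x.
  rewrite /B power_seriesD // ?sS ?power_seriesZ //; last exact/tameZ/tame_shifted.
    by congr (_ + _); apply: eq_bigr => j _; rewrite mul1r.
  exact: tame_shifted.
have BE n : B n = (a + (deg n)%:R) * shifted_coef v n.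
  rewrite /B mulrDl natr_sum mulr_suml; congr (_ + _).
  by apply: eq_bigr => j _; rewrite mul1r.
have := has_sumZ (v k)%:R (power_series_shift k tB xD); rewrite BT.
move/(has_sumD (has_sumD (has_sumZ (- beta (v k) k) (Ls v))
                         (has_sumZ (- beta (~~ v k) k) (Ls (flip k v))))).
move=> h; rewrite /edge opprD -!mulNr.
apply: has_sum_unique (has_sum_power_series (tame_theta k v) xD) _.
apply: (eq_ind _ (fun f => has_sum f _) h); apply/funext => n.
rewrite /theta_coef theta_shifted_coef /edge BE.
by case: ifP => _; ring.
Qed.

Lemma T_shifted v x : DD x ->
  one_minus v x * T v x = a * sh v x + \sum_k edge b c (fun w => sh w x) k v.
Proof.
move=> xD; rewrite /one_minus mulrBl mul1r {1}/T.
under eq_bigr do rewrite theta_shifted //.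
rewrite big_split /= addrA mulr_suml; apply/eqP; rewrite subr_eq; apply/eqP.
by congr (_ + _); apply: eq_bigr => k _; rewrite mulrA.
Qed.

End LauricellaSystem.

(** On D one has |v.x| <= sum_i |x_i| < 1. *)
Lemma one_minus_neq0 (K : numClosedFieldType) m (v : Z2 m) (x : 'rV[K]_m) :
  DD x -> one_minus v x != 0.
Proof.
move=> xD; apply/eqP => /eqP; rewrite subr_eq0 => /eqP e.
have : (1 : K) <= \sum_i `|x 0 i|.
  rewrite -[leLHS]normr1 e; apply: le_trans (ler_norm_sum _ _ _) _.
  apply: ler_sum => i _; case: (v i); first by rewrite mul1r.
  by rewrite mul0r normr0.
by move=> /le_gtF; rewrite (xD : _ < 1).
Qed.

(** * The entries F_v as power series *)

Section ThetaProd.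
Context {R : realType} {m : nat}.
Local Notation K := (CC R).

Lemma theta_seq_power_series (r : seq 'I_m) f A (x : 'rV[K]_m) : tame A ->
  in_torus_domain x -> (forall y, in_torus_domain y -> f y = power_series A y) ->
  foldr theta f r x = power_series (foldr theta_coef A r) x.
Proof.
move=> tA + fE; elim: r x => [|i r IH] x xT /=; first exact: fE.
apply: theta_power_series => //; elim: (r) => //= j s; exact: tame_idx.
Qed.

Lemma foldr_theta_coef (r : seq 'I_m) (A : {ffun 'I_m -> nat} -> K) n :
  foldr theta_coef A r n = \prod_(i <- r) (n i)%:R * A n.
Proof.
elim: r => [|i r IH]; first by rewrite big_nil mul1r.
by rewrite big_cons -mulrA -IH.
Qed.

End ThetaProd.

Lemma theta_prod_power_series (R : realType) m (a : CC R) (b c : 'I_m -> CC R) v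
    (x : 'rV[CC R]_m) :
  (forall i (n : nat), c i != - n%:R) -> in_torus_domain x ->
  theta_prod v (F_zero a b c) x
  = power_series (theta_prod_coef a b c
      (\prod_i (Gamma (b i) * Gamma (c i - b i) / Gamma (c i))) v) x.
Proof.
move=> hc xT; set kappa := \prod_i _.
have tL := tame_lauricella (@CC_archimedean R) a b hc.
have tK := tameZ kappa tL.
rewrite /theta_prod (theta_seq_power_series _ tK xT); last first.
  by move=> y [yD _]; rewrite power_seriesZ.
congr power_series; apply/funext => n.
rewrite foldr_theta_coef /theta_prod_coef big_filter big_enum_cond /= big_mkcond.
congr (_ * _); apply: eq_bigr => i _.
by case: (v i) => /=; rewrite ?mul1r ?addr0 ?mul0r ?add0r.
Qed.

Unset Implicit Arguments.

Theorem corollary4p3 (R : realType) (m : nat) (hm : (1 <= m)%N)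
    (a : CC R) (b c : 'I_m -> CC R)
    (hc : forall (i : 'I_m) (n : nat), c i != - n%:R)
    (hbeta : forall (e : bool) (i : 'I_m) (z : int), beta b c e i != z%:~R)
    (hgamma : forall (v : Z2 m) (z : int), gamma a c v != z%:~R) :
  P_mx b c \in unitmx /\
  forall x : 'rV[CC R]_m, DD x -> (forall i : 'I_m, x 0 i != 0) ->
    differentiable (F_vec a b c) x /\
    forall h : 'rV[CC R]_m,
      'd (F_vec a b c) x h
      = (P_mx b c *m Xi a b c x h *m invmx (P_mx b c)) *m F_vec a b c x.
Proof.
have beta0 e i : beta b c e i != 0 := hbeta e i 0.
have gamma0 v : gamma a c v != 0 := hgamma v 0.
(* At v = 0 the number gamma_v is a itself. *)
have a0 : a != 0.
  have := gamma0 (zero_vec m); rewrite /gamma /weight !big1 ?subr0 ?addr0 // => i _;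
  by rewrite ffunE ?mul0r.
have Pu := P_mx_unit beta0; split=> // x xD x0.
have xT : in_torus_domain x by [].
set kappa := \prod_i (Gamma (b i) * Gamma (c i - b i) / Gamma (c i)).
pose S w := shifted_coef a b c kappa w.
have tS w : tame (S w) by exact: tame_shifted.
have FcE v : theta_prod_coef a b c kappa v
    = fun n => \sum_w p_coef b c v w * S w n.
  by apply/funext => n; exact: theta_prod_coefE.
have tF v : tame (theta_prod_coef a b c kappa v).
  by rewrite FcE; exact: (power_series_sum (index_enum _) (p_coef b c v) tS xD).1.
have Fd v := differentiable_power_series (tF v) xT
  (fun y yT => theta_prod_power_series a b v hc yT).
have [dF dFE] := differentiable_col (fun y => erefl (F_vec a b c y))
  (fun k => (Fd (vec_at k)).1).
split=> // h; rewrite dFE.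
pose g w := power_series (S w) x.
(* F = P g, so P^-1 cancels and it remains to compare dF with P applied to the system for g. *)
have FE : F_vec a b c x = P_mx b c *m \col_k g (vec_at k).
  apply/colP => k; rewrite mxE theta_prod_power_series // -/kappa FcE mxE.
  rewrite (power_series_sum (index_enum _) (p_coef b c (vec_at k)) tS xD).2.
  rewrite -(sum_vec_at (fun w => p_coef b c (vec_at k) w * g w)).
  by apply: eq_bigr => l _; rewrite !mxE.
rewrite FE -!mulmxA (mulKmx Pu) Xi_mul //.
apply/colP => k; rewrite mxE (Fd (vec_at k)).2 mxE.
pose th j w := power_series (theta_coef j (S w)) x.
(* The differential of F_v, expanded through the logarithmic derivatives of the g_w. *)
transitivity (\sum_w p_coef b c (vec_at k) w * \sum_j h 0 j / x 0 j * th j w).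
  under [RHS]eq_bigr do rewrite mulr_sumr.
  rewrite exchange_big /=; apply: eq_bigr => j _.
  have -> : theta_coef j (theta_prod_coef a b c kappa (vec_at k))
      = fun n => \sum_w p_coef b c (vec_at k) w * theta_coef j (S w) n.
    apply/funext => n; rewrite /theta_coef theta_prod_coefE // mulr_sumr.
    by apply: eq_bigr => w _; rewrite mulrCA.
  have tT w : tame (theta_coef j (S w)) by exact: tame_idx.
  rewrite (power_series_sum (index_enum _) (p_coef b c (vec_at k)) tT xD).2.
  by rewrite mulr_sumr; apply: eq_bigr => w _; rewrite mulrCA.
rewrite -sum_vec_at; apply: eq_bigr => l _; rewrite !mxE; congr (_ * _).
set v := vec_at l; rewrite dlog_one_minus mulNr mulNr opprK.
(* Replaces a g_v + sum_j E_j by (1 - v.x) (theta + a) g_v, which cancels the denominator of dlog (1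
   - v.x); the rest is compared for each dx_j. *)
rewrite -(T_shifted a kappa hc beta0 v xD) -mulrA mulKf ?one_minus_neq0 //.
rewrite mulr_suml -big_split /=; apply: eq_bigr => j _.
rewrite dlog_coord_fun /th theta_shifted //.
have := x0 j; move: (x 0 j) (_ + _) (edge _ _ _ _ _) => y T E y0.
by field.
Qed.
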